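(* Let $r,k\in\mathbb Z$, $0\le k\le r$, and suppose that $U\in Y_r$ solves $Q^r_k\text{-}\mathbf{VTD}^r_k$. For every $n=1,\dots,N$ set $$\widetilde U|_{I_n}=U|_{I_n}-\tilde a_n\tilde\vartheta_n,\qquad\tilde\vartheta_n\in P_{r+1}(I_n,\mathbb R),$$ where $\tilde\vartheta_n$ vanishes in all $r+1$ quadrature points of $Q^r_k$ (counted with multiplicity) and additionally satisfies $\tilde\vartheta_n^{(\lfloor\frac{k-1}{2}\rfloor+1)}(t_{n-1}^+)=1$. The vector $\tilde a_n\in\mathbb R^d$ is defined (successively in $n$) by $$\tilde a_n:=\begin{cases}U^{(\lfloor\frac{k-1}{2}\rfloor+1)}(t_0^+)-u^{(\lfloor\frac{k-1}{2}\rfloor+1)}(t_0),&n=1,\\[2pt]U^{(\lfloor\frac{k-1}{2}\rfloor+1)}(t_{n-1}^+)-\widetilde U^{(\lfloor\frac{k-1}{2}\rfloor+1)}(t_{n-1}^-),&n>1.\end{cases}$$ Moreover, let $\widetilde U(t_0^-)=U(t_0^-)$. Then $\widetilde U\in Y_{r+1}$ solves $Q^r_k\text{-}\mathbf{VTD}^{r+1}_{k+2}$.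
   Context: Problem: $M u'(t)=F(t,u(t))$, $u(t_0)=u_0\in\mathbb R^d$, on $I=(t_0,t_0+T]$, $T>0$, with $M\in\mathbb R^{d\times d}$ regular; $F$ is sufficiently smooth (all derivatives of $F$ that occur exist and are continuous) and Lipschitz continuous in its second variable. The values $u^{(j)}(t_0)$ are defined recursively by $u^{(0)}(t_0)=u_0$ and $M u^{(j)}(t_0)=\frac{\mathrm d^{j-1}}{\mathrm dt^{j-1}}F(t,u(t))\big|_{t=t_0}$, $j\ge1$ (the right-hand side, expanded by the chain rule, depends only on $u(t_0),\dots,u^{(j-1)}(t_0)$). Notation: mesh $t_0<t_1<\dots<t_N=t_0+T$, $I_n=(t_{n-1},t_n]$, $\tau_n=t_n-t_{n-1}$. $(\cdot,\cdot)$ is the Euclidean inner product on $\mathbb R^d$. $P_s(J,\mathbb R^q)$ is the space of $\mathbb R^q$-valued polynomials on $J$ of degree $\le s$, and $P_{-1}=\{0\}$. $Y_s$ is the space of functions $\varphi\in L^2(I,\mathbb R^d)$ with $\varphi|_{I_n}\in P_s(I_n,\mathbb R^d)$ for all $n=1,\dots,N$. $v(t_n^\pm)$ are one-sided limits (derivatives of piecewise polynomials are taken interval-wise), $[v]_n=v(t_n^+)-v(t_n^-)$. $\delta_{i,j}$ is the Kronecker delta. Note $\lfloor (k-1)/2\rfloor=-1$ for $k=0$. Quadrature: for $0\le k\le r$ let $\widehat{\mathcal I}^r_k:C^{\lfloor k/2\rfloor}([-1,1])\to P_r([-1,1])$ be the Hermite interpolation operator preserving derivatives of orders $0,\dots,\lfloor\frac{k-1}{2}\rfloor$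 at $-1$ (none if $k=0$), derivatives of orders $0,\dots,\lfloor\frac k2\rfloor$ at $+1$, and the function values at the zeros $\hat t_1,\dots,\hat t_{r-k}\in(-1,1)$ of the $(r-k)$th Jacobi polynomial with respect to the weight $(1+\hat t)^{\lfloor\frac{k-1}{2}\rfloor+1}(1-\hat t)^{\lfloor\frac k2\rfloor+1}$. Let $\widehat Q^r_k[\hat f]=\int_{-1}^1\widehat{\mathcal I}^r_k\hat f\,\mathrm d\hat t$. $\mathcal I^r_k$ and $Q^r_k$ denote their affine transformations to $I_n$ (so $Q^r_k[\varphi]=\int_{I_n}\mathcal I^r_k\varphi\,\mathrm dt$), and $t_{n,i}=\frac12(t_{n-1}+t_n+\tau_n\hat t_i)$. The $r+1$ quadrature points of $Q^r_k$ on $I_n$, counted with multiplicity, are $t_{n-1}$ with multiplicity $\lfloor\frac{k-1}{2}\rfloor+1$, $t_n$ with multiplicity $\lfloor\frac k2\rfloor+1$, and $t_{n,1},\dots,t_{n,r-k}$ each simple; ''vanishing in all quadrature points'' means having zeros of (at least) these multiplicities. Method: for a quadrature rule $Q$ on $I_n$ and integers $s\ge0$, $0\le m\le s+1$, a function $V\in Y_s$ with $V(t_0^-)=u_0$ solves $Q\text{-}\mathbf{VTD}^s_m$ if for every $n=1,\dots,N$: (1) if $m\ge1$: $V(t_{n-1}^+)=V(t_{n-1}^-)$; (2) if $m\ge2$: $M V^{(i+1)}(t_n^-)=\frac{\mathrm d^i}{\mathrm dt^i}\big(F(t,V(t))\big)\big|_{t=t_n^-}$ for $i=0,\dots,\lfloor\frac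 m2\rfloor-1$; (3) if $m\ge3$: $M V^{(i+1)}(t_{n-1}^+)=\frac{\mathrm d^i}{\mathrm dt^i}\big(F(t,V(t))\big)\big|_{t=t_{n-1}^+}$ for $i=0,\dots,\lfloor\frac{m-1}2\rfloor-1$; (4) $Q\big[(MV',\varphi)\big]+\delta_{0,m}\big(M[V]_{n-1},\varphi(t_{n-1}^+)\big)=Q\big[(F(\cdot,V(\cdot)),\varphi)\big]$ for all $\varphi\in P_{s-m}(I_n,\mathbb R^d)$ (no condition if $m=s+1$). *)

(* Defs.v *)
(* The mathematics below is set in MathComp and MathComp-Analysis, over an
   arbitrary R : realType. *)
From HB Require Import structures.
From mathcomp Require Import all_boot all_order all_algebra.
From mathcomp Require Import all_classical all_reals all_analysis.

Set Implicit Arguments.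
Unset Strict Implicit.
Unset Printing Implicit Defensive.

Import Order.TTheory GRing.Theory Num.Theory.
Import numFieldNormedType.Exports.

Local Open Scope classical_set_scope.
Local Open Scope ring_scope.

(* The one-sided limits v(a^+) and v(a^-). *)
Definition right_lim (R : realType) (V : normedModType R) (v : R -> V) (a : R)
  : V := lim (v x @[x --> a^'+]).

Definition left_lim (R : realType) (V : normedModType R) (v : R -> V) (a : R)
  : V := lim (v x @[x --> a^'-]).

Definition dot (R : realType) (d : nat) (x y : 'cV[R]_d) : R :=
  \sum_i x i ord0 * y i ord0.

(* f is C^j on the closed strip [a, b] x R^d: it is continuous there, it is j
   times differentiable on the open strip, and its derivatives up to order j
   extend continuously to the closed strip. *)
Fixpoint Cj_strip (R : realType) (d : nat) (a b : R) (j : nat)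
    (f : R * 'cV[R]_d -> 'cV[R]_d) : Prop :=
  {within [set z | a <= z.1 <= b], continuous f} /\
  if j is j'.+1 then
    (forall z, a < z.1 < b -> differentiable f z) /\
    (forall v, exists2 g, Cj_strip a b j' g &
       forall z, a < z.1 < b -> 'D_v f z = g z)
  else True.

(* ud j stands for u^(j)(t0). By the chain rule, the derivative of order j at t0
   of F(t, u(t)) depends on u only through u(t0), ..., u^(j)(t0), so that u may
   be replaced by its Taylor polynomial of degree j at t0. The derivative at t0
   is a right limit since F is only relevant for t >= t0. *)
Definition initial_derivatives (R : realType) (d : nat)
    (F : R * 'cV[R]_d -> 'cV[R]_d) (M : 'M[R]_d) (t0 : R) (u0 : 'cV[R]_d)
    (ud : nat -> 'cV[R]_d) : Prop :=
  ud 0%N = u0 /\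
  forall j : nat,
    let taylor x := \sum_(i < j.+1) ((x - t0) ^+ i / (i`!)%:R) *: ud i in
    M *m ud j.+1 = right_lim (derive1n j (fun x => F (x, taylor x))) t0.

(* The nodes are t 0, ..., t N; the other values of t are irrelevant. *)
Definition mesh (R : realType) (t0 T : R) (N : nat) (t : nat -> R) : Prop :=
  [/\ t 0%N = t0, t N = t0 + T & forall n, (n < N)%N -> t n < t n.+1].

Definition vpoly (R : realType) (d : nat) (p : 'cV[{poly R}]_d) (x : R)
  : 'cV[R]_d := \col_i (p i ord0).[x].

Definition vdeg_lt (R : realType) (d : nat) (s : nat) (p : 'cV[{poly R}]_d)
  : Prop := forall i, (size (p i ord0) <= s)%N.

(* The space Y_s. Membership in L^2 is automatic, as there are finitely many
   bounded mesh intervals. Values of V outside of (t 0, t N] are irrelevant. *)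
Definition inY (R : realType) (d : nat) (N : nat) (t : nat -> R) (s : nat)
    (V : R -> 'cV[R]_d) : Prop :=
  forall n, (0 < n <= N)%N ->
    exists2 p, vdeg_lt s.+1 p & forall x, t n.-1 < x <= t n -> V x = vpoly p x.

(* Orthogonal polynomial of degree n on [-1, 1] for (1 + x)^a (1 - x)^b; it is
   unique up to a nonzero factor. *)
Definition is_jacobi (R : realType) (n a b : nat) (P : {poly R}) : Prop :=
  size P = n.+1 /\
  forall q : {poly R}, (size q <= n)%N ->
    \int[lebesgue_measure]_(x in `[-1, 1])
      ((1 + x) ^+ a * (1 - x) ^+ b * P.[x] * q.[x]) = 0.

(* Multiplicities floor((k-1)/2) + 1 and floor(k/2) + 1 of the left and right
   end points. *)
Definition mult_left (k : nat) : nat := uphalf k.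
Definition mult_right (k : nat) : nat := k./2.+1.

Definition jacobi_nodes (R : realType) (r k : nat) (th : 'I_(r - k) -> R)
  : Prop :=
  exists2 P, is_jacobi (r - k) (mult_left k) (mult_right k) P &
    injective th /\ forall i, -1 < th i < 1 /\ root P (th i).

Definition hermite_conditions (R : realType) (r k : nat) (th : 'I_(r - k) -> R)
    (f : R -> R) (p : {poly R}) : Prop :=
  [/\ (size p <= r.+1)%N,
      forall i, (i < mult_left k)%N ->
        (derivn i p).[-1] = right_lim (derive1n i f) (-1),
      forall i, (i < mult_right k)%N ->
        (derivn i p).[1] = left_lim (derive1n i f) 1 &
      forall i, p.[th i] = f (th i)].

Definition hermite (R : realType) (r k : nat) (th : 'I_(r - k) -> R)
    (f : R -> R) : {poly R} :=
  xget 0 [set p | hermite_conditions th f p].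

(* The affine bijection from [-1, 1] onto [a, b] and its inverse. *)
Definition from_ref (R : realType) (a b x : R) : R :=
  (a + b + (b - a) * x) / 2.

Definition to_ref (R : realType) (a b x : R) : R :=
  (2 * x - a - b) / (b - a).

(* The quadrature rule Q^r_k on (t n.-1, t n]. *)
Definition Qrk (R : realType) (t : nat -> R) (r k : nat) (th : 'I_(r - k) -> R)
    (n : nat) (f : R -> R) : R :=
  let p := hermite th (f \o from_ref (t n.-1) (t n)) in
  \int[lebesgue_measure]_(x in `]t n.-1, t n]) p.[to_ref (t n.-1) (t n) x].

(* V(t_n^-); since V lives on (t 0, t N], V(t_0^-) is a separate datum V0. *)
Definition left_value (R : realType) (d : nat) (t : nat -> R)
    (V : R -> 'cV[R]_d) (V0 : 'cV[R]_d) (n : nat) : 'cV[R]_d :=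
  if n is 0 then V0 else left_lim V (t n).

(* V, with V(t_0^-) = V0, solves Q-VTD^s_m, where Q n is a rule on
   (t n.-1, t n]. Subtractions on nat truncate; for m <= s + 1 the bound
   s.+1 - m on the size of phi is the degree bound s - m. *)
Definition VTD (R : realType) (d : nat) (F : R * 'cV[R]_d -> 'cV[R]_d)
    (M : 'M[R]_d) (u0 : 'cV[R]_d) (N : nat) (t : nat -> R)
    (Q : nat -> (R -> R) -> R) (s m : nat)
    (V : R -> 'cV[R]_d) (V0 : 'cV[R]_d) : Prop :=
  [/\ inY N t s V, V0 = u0 &
   forall n, (0 < n <= N)%N ->
   [/\ ((1 <= m)%N -> right_lim V (t n.-1) = left_value t V V0 n.-1),
       ((2 <= m)%N -> forall i, (i < m./2)%N ->
          M *m left_lim (derive1n i.+1 V) (t n)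
          = left_lim (derive1n i (fun x => F (x, V x))) (t n)),
       ((3 <= m)%N -> forall i, (i < m.-1./2)%N ->
          M *m right_lim (derive1n i.+1 V) (t n.-1)
          = right_lim (derive1n i (fun x => F (x, V x))) (t n.-1)) &
       forall phi : 'cV[{poly R}]_d, vdeg_lt (s.+1 - m) phi ->
          Q n (fun x => dot (M *m derive1 V x) (vpoly phi x))
          + (m == 0%N)%:R
            * dot (M *m (right_lim V (t n.-1) - left_value t V V0 n.-1))
                  (vpoly phi (t n.-1))
          = Q n (fun x => dot (F (x, V x)) (vpoly phi x))]].

(* theta vanishes in all quadrature points of Q^r_k on (a, b], counted with
   multiplicity. *)
Definition vanishes_at_nodes (R : realType) (r k : nat) (th : 'I_(r - k) -> R)
    (a b : R) (theta : {poly R}) : Prop :=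
  [/\ ('X - a%:P) ^+ mult_left k %| theta,
      ('X - b%:P) ^+ mult_right k %| theta &
      forall i, root theta (from_ref a b (th i))].

(* Main.v *)
Require Import Defs.
From HB Require Import structures.
From mathcomp Require Import all_boot all_order all_algebra.
From mathcomp Require Import all_classical all_reals all_analysis.
From mathcomp Require Import measurable_realfun ring lra zify.

Import Order.TTheory GRing.Theory Num.Theory.
Import numFieldNormedType.Exports.
Local Open Scope classical_set_scope.
Local Open Scope ring_scope.

Set Implicit Arguments.
Unset Strict Implicit.
Unset Printing Implicit Defensive.

(** Write L and l for the multiplicities of the left and right end points, so
    that L + l = k + 1, and [a, b] for a mesh interval on which U = p, Ut = q
    with polynomials p and q = p - theta * a_n.

    As theta vanishes at the nodes with their multiplicities, F(., U) and
    F(., Ut) have the same Hermite data there, and the rule does not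
    distinguish them (Qrk_F_corrected).  On the other side of the variational
    equation, M U' and M Ut' times a test function of degree <= r - k are
    polynomials of degree <= 2r - k.  The rule integrates them exactly because
    the nodal polynomial is orthogonal to all polynomials of degree < r - k
    (Qrk_exact).
    Integrating by parts, the same orthogonality shows that the integral of
    theta' psi is minus the boundary value psi(a) if k = 0, and 0 otherwise
    (pint_bubble); for k = 0 this is how the jump term of the discontinuous
    method disappears.  Hence q satisfies, without any jump term, the equation
    that p satisfies, for all test functions of degree <= r - k
    (Qrk_corrected).  This is one degree more than the new method asks for.

    The spare test function gives the new collocation condition at b.  Take
    the polynomial with the interior nodes as simple roots.  Its product with
    the residual M q' - F(., q) has Hermite data that all vanish except for the
    derivative of order k./2 at b, so the equation says that this derivative
    times the last weight of the rule is zero, and that weight is not zero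
    (Qrk_last_condition, collocation_right).

    The new condition at a comes from the choice of a_n.  It makes the
    derivative of order L of Ut continuous at a; the lower ones are continuous
    by the collocation conditions of U.  The derivatives of F(., Ut) at a up to
    order L - 1 depend on nothing else, so the collocation conditions of Ut at
    the right end of the previous interval (or those of the initial data) carry
    over.  As these in turn were obtained on the previous interval, the
    argument is an induction over the mesh.

    The analysis behind this is the chain rule in the following form: the
    one-sided derivatives at c of x |-> F (x, p x) up to the order of
    smoothness of F exist, and the one of order n is a function of c and of the
    derivatives of p at c up to order n (total_derivatives).  One-sided
    derivatives are handled through the predicate jet, and the Leibniz rule
    through polynomials with prescribed derivatives at c (jetM, ex_taylor). *)

(** * One-sided jets of real functions *)

(** What c^'+ and c^'- have in common: a property that holds near such a filter
    holds on an open set near it, so that it may be differentiated there. *)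
Definition one_sided (R : realType) (c : R) (G : set_system R) : Prop :=
  [/\ ProperFilter G, G --> nbhs c &
      forall P : set R, G P -> G (fun x => nbhs x P)].

Lemma one_sided_right (R : realType) (c : R) : one_sided c c^'+.
Proof.
split; first exact: at_right_proper_filter.
  exact: cvg_within.
move=> P cP; have : \forall x \near c, nbhs x (fun x => c < x -> P x).
  exact: (nbhs_interior cP).
move=> H; near=> x.
have cx : c < x by near: x; exact: nbhs_right_gt.
have Hx : nbhs x (fun x => c < x -> P x).
  near: x; exact: cvg_within H.
near=> y.
have : c < y by near: y; exact: lt_nbhsr.
by near: y.
Unshelve. all: by end_near. Qed.

Lemma one_sided_left (R : realType) (c : R) : one_sided c c^'-.
Proof.
split; first exact: at_left_proper_filter.
  exact: cvg_within.
move=> P cP; have : \forall x \near c, nbhs x (fun x => x < c -> P x).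
  exact: (nbhs_interior cP).
move=> H; near=> x.
have cx : x < c by near: x; exact: nbhs_left_lt.
have Hx : nbhs x (fun x => x < c -> P x).
  near: x; exact: cvg_within H.
near=> y.
have : y < c by near: y; exact: lt_nbhsl.
by near: y.
Unshelve. all: by end_near. Qed.

Lemma near_right_oo (R : realType) (a b : R) : a < b ->
  \forall x \near a^'+, a < x < b.
Proof.
move=> ab; near=> x; apply/andP; split; first by near: x; exact: nbhs_right_gt.
by near: x; exact: nbhs_right_lt.
Unshelve. all: by end_near. Qed.

Lemma near_left_oo (R : realType) (a b : R) : a < b ->
  \forall x \near b^'-, a < x < b.
Proof.
move=> ab; near=> x; apply/andP; split; first by near: x; exact: nbhs_left_gt.
by near: x; exact: nbhs_left_lt.
Unshelve. all: by end_near. Qed.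

(** The derivatives of f of orders 0, ..., m - 1 tend to s 0, ..., s m.-1 along
    G, and f is near G differentiable often enough for them to be meaningful:
    derive1 has a default value where f is not differentiable. *)
Fixpoint jet (R : realType) (G : set_system R) (m : nat) (f : R -> R)
    (s : nat -> R) : Prop :=
  if m is m'.+1 then
    [/\ f x @[x --> G] --> s 0%N,
        (0 < m')%N -> \forall x \near G, derivable f x 1 &
        jet G m' (derive1 f) (s \o succn)]
  else True.

Definition pjet (R : realType) (p : {poly R}) (c : R) (i : nat) : R :=
  (derivn i p).[c].

Section Jets.
Context {R : realType} (c : R) (G : set_system R) (hG : one_sided c G).
Implicit Types (f g : R -> R) (s : nat -> R) (p q : {poly R}).

Let GP : ProperFilter G. Proof. by case: hG. Qed.
Local Existing Instance GP.

Lemma one_sided_near_eq (V : normedModType R) (f g : R -> V) :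
  (\forall x \near G, f x = g x) ->
  \forall x \near G, [/\ f x = g x, derive1 f x = derive1 g x &
     derivable f x 1 <-> derivable g x 1].
Proof.
case: hG => _ _ hO fg; have fg' := hO _ fg.
apply: filter_app fg'; apply: filter_app fg; near=> x => fgx fg'; split=> //.
  by rewrite !derive1E; apply: near_eq_derive.
split; apply: near_eq_derivable => //.
by apply: filterS fg'.
Unshelve. all: by end_near. Qed.

Lemma jet_ext m f g s s' : (\forall x \near G, f x = g x) ->
  (forall i, (i < m)%N -> s i = s' i) -> jet G m f s -> jet G m g s'.
Proof.
elim: m f g s s' => [//|m IH] f g s s' /one_sided_near_eq fg ss' /= [fs df jf].
split.
- rewrite -ss'//; apply: cvg_trans fs; apply: near_eq_cvg.
  by apply: filterS fg => x [].
- move=> /df; apply: filter_app; apply: filterS fg => x [_ _ h] /h; exact.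
- apply: IH jf; first by apply: filterS fg => x [].
  by move=> i im; rewrite /= ss'.
Qed.

Lemma jet_mono m m' f s : (m' <= m)%N -> jet G m f s -> jet G m' f s.
Proof.
elim: m m' f s => [|m IH] [|m']//= f s mm [fs df jf]; split => //.
  by move=> m0; apply: df; exact: leq_trans m0 mm.
exact: IH jf.
Qed.

Lemma jet_lim m f s i : jet G m f s -> (i < m)%N ->
  derive1n i f x @[x --> G] --> s i.
Proof.
elim: m f s i => [//|m IH] f s [|i] [fs df jf] im; first exact: fs.
rewrite (_ : derive1n i.+1 f = derive1n i (derive1 f)).
  exact: IH jf im.
by rewrite /derive1n iterSr.
Qed.

Lemma jet_horner m p : jet G m (horner p) (pjet p c).
Proof.
elim: m p => [//|m IH] p /=; split.
- rewrite /pjet derivn0; case: hG => _ Gc _.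
  apply: (@cvg_trans _ (horner p @ nbhs c)); last exact: continuous_horner.
  exact: cvg_app.
- by move=> _; near=> x; exact: derivable_horner.
- rewrite -derivE; apply: jet_ext (IH (p^`())); first by near=> x.
  by move=> i _; rewrite /comp /pjet derivSn.
Unshelve. all: by end_near. Qed.

Lemma jetD m f g s s' : jet G m f s -> jet G m g s' ->
  jet G m (fun x => f x + g x) (fun i => s i + s' i).
Proof.
elim: m f g s s' => [//|m IH] f g s s' /= [fs df jf] [gs dg jg]; split.
- exact: cvgD.
- move=> m0; apply: filter_app (dg m0); apply: filterS (df m0) => x.
  exact: derivableD.
- case: m IH df dg jf jg => [//|m] IH df dg jf jg.
  apply: jet_ext (IH _ _ _ _ jf jg) => //.
  apply: filter_app (dg isT); apply: filterS (df isT) => x fx gx.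
  by rewrite !derive1E -(deriveD fx gx).
Qed.

(** For jets given by polynomials the Leibniz rule needs no binomial
    coefficients: the derivative of p * q already contains them. *)
Lemma jetM m f g p q : jet G m f (pjet p c) -> jet G m g (pjet q c) ->
  jet G m (fun x => f x * g x) (pjet (p * q) c).
Proof.
elim: m f g p q => [//|m IH] f g p q jf jg.
have jf0 := jet_mono (leqnSn m) jf; have jg0 := jet_mono (leqnSn m) jg.
move: jf jg => /= [fs df jf] [gs dg jg]; split.
- move: fs gs; rewrite /pjet !derivn0 => fs gs; rewrite hornerM; exact: cvgM.
- move=> m0; apply: filter_app (dg m0); apply: filterS (df m0) => x.
  exact: derivableM.
- case: m IH df dg jf jg jf0 jg0 => [//|m] IH df dg jf jg jf0 jg0.
  have jS h P : jet G m.+1 h (pjet P c \o succn) ->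
      jet G m.+1 h (pjet P^`() c).
    by apply: jet_ext; [near=> x|move=> i _; rewrite /comp /pjet derivSn].
  have := jetD (IH _ _ _ _ (jS _ _ jf) jg0) (IH _ _ _ _ jf0 (jS _ _ jg)).
  apply: jet_ext.
    apply: filter_app (dg isT); apply: filterS (df isT) => x fx gx.
    rewrite !derive1E (deriveM fx gx) addrC; congr (_ + _).
    by rewrite /GRing.scale /= mulrC.
  by move=> i _; rewrite /comp /pjet derivSn derivM derivnD hornerD.
Unshelve. all: by end_near. Qed.

Lemma jet_sum (I : Type) (r : seq I) m (f : I -> R -> R) (p : I -> {poly R}) :
  (forall j, jet G m (f j) (pjet (p j) c)) ->
  jet G m (fun x => \sum_(j <- r) f j x) (pjet (\sum_(j <- r) p j) c).
Proof.
move=> h; elim: r => [|j r IH].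
  rewrite big_nil; apply: jet_ext (jet_horner m 0) => //.
  by near=> x; rewrite big_nil horner0.
rewrite big_cons; apply: jet_ext (jetD (h j) IH).
  by near=> x; rewrite big_cons.
by move=> i _; rewrite /pjet derivnD hornerD.
Unshelve. all: by end_near. Qed.

End Jets.

(** * Derivatives of polynomials at a point *)

Section TaylorPoly.
Context {R : realType} (c : R).
Implicit Types (p q : {poly R}) (s : nat -> R).

Lemma pjetS p i : pjet p c i.+1 = pjet p^`() c i.
Proof. by rewrite /pjet derivSn. Qed.

Lemma pjetD p q i : pjet (p + q) c i = pjet p c i + pjet q c i.
Proof. by rewrite /pjet derivnD hornerD. Qed.

Lemma pjetB p q i : pjet (p - q) c i = pjet p c i - pjet q c i.
Proof. by rewrite /pjet derivnB hornerD hornerN. Qed.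

Lemma pjetZ a p i : pjet (a *: p) c i = a * pjet p c i.
Proof. by rewrite /pjet derivnZ hornerZ. Qed.

Lemma pjet_dvdp p m i : ('X - c%:P) ^+ m %| p -> (i < m)%N -> pjet p c i = 0.
Proof.
elim: i m p => [|i IH] [|m] p //=.
  by rewrite exprS => /dvdpP[q ->] _; rewrite /pjet derivn0 !hornerM hornerXsubC
    subrr mul0r mulr0.
move=> /dvdpP[q ->] im; rewrite pjetS; apply: (IH m) => //.
rewrite derivM deriv_exp derivXsubC mul1r /=.
apply: dvdp_add; first by rewrite exprS mulrA dvdp_mull.
by rewrite mulrnAr -mulrnAl dvdp_mull.
Qed.

Lemma pjet_top q m : pjet (q * ('X - c%:P) ^+ m) c m = q.[c] *+ m`!.
Proof.
elim: m q => [|m IH] q; first by rewrite expr0 mulr1 /pjet derivn0.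
rewrite pjetS derivM deriv_exp derivXsubC mul1r /= pjetD.
rewrite (@pjet_dvdp _ m.+1)//; last by rewrite dvdp_mull.
by rewrite add0r mulrnAr -mulrnAl IH hornerMn -mulrnA -factS.
Qed.

(** Holds in characteristic zero only: the derivative of order m of
    q * (X - c)^m at c is m! q(c). *)
Lemma dvdp_pjet p m :
  (forall i, (i < m)%N -> pjet p c i = 0) <-> ('X - c%:P) ^+ m %| p.
Proof.
split; last by move=> h i; exact: pjet_dvdp.
elim: m => [|m IH] h; first by rewrite expr0 dvd1p.
have /dvdpP[q pE] := IH (fun i im => h i (ltnW im)).
move: (h m (leqnn _)); rewrite pE pjet_top => /eqP.
rewrite -mulr_natr mulf_eq0 pnatr_eq0 gtn_eqF ?fact_gt0// orbF => q0.
by rewrite exprS dvdp_mul2r ?expf_neq0 ?polyXsubC_eq0// dvdp_XsubCl.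
Qed.

Lemma dvdpB_pjet p q m :
  (forall i, (i < m)%N -> pjet p c i = pjet q c i) <->
  ('X - c%:P) ^+ m %| p - q.
Proof.
split.
  by move=> h; apply/dvdp_pjet => i im; rewrite pjetB h// subrr.
by move=> h i im; apply/eqP; rewrite -subr_eq0 -pjetB (pjet_dvdp h im).
Qed.

(** Turns any jet into the jet of a polynomial, to which jetM applies. *)
Lemma ex_taylor s m : exists p, forall i, (i < m)%N -> pjet p c i = s i.
Proof.
elim: m => [|m [p IH]]; first by exists 0.
exists (p + ((s m - pjet p c m) / m`!%:R)%:P * ('X - c%:P) ^+ m) => i.
rewrite pjetD ltnS leq_eqVlt => /predU1P[->|im].
  rewrite pjet_top hornerC -mulr_natr divfK ?pnatr_eq0 -?lt0n ?fact_gt0//.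
  by rewrite subrKC.
by rewrite IH// (@pjet_dvdp _ m)// ?addr0// dvdp_mull.
Qed.

End TaylorPoly.

(** * The affine map from the reference interval *)

Definition from_ref_poly (R : realType) (a b : R) : {poly R} :=
  ((b - a) / 2) *: 'X + ((a + b) / 2)%:P.
Definition to_ref_poly (R : realType) (a b : R) : {poly R} :=
  (2 / (b - a)) *: 'X - ((a + b) / (b - a))%:P.

Lemma horner_from_ref_poly (R : realType) (a b x : R) :
  (from_ref_poly a b).[x] = from_ref a b x.
Proof. by rewrite /from_ref_poly /from_ref !hornerE; field. Qed.

Lemma horner_to_ref_poly (R : realType) (a b x : R) : a < b ->
  (to_ref_poly a b).[x] = to_ref a b x.
Proof.
by move=> ab; rewrite /to_ref_poly /to_ref !hornerE; field; rewrite subr_eq0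
  gt_eqF.
Qed.

Lemma from_refK (R : realType) (a b : R) : a < b ->
  cancel (from_ref a b) (to_ref a b).
Proof.
by move=> ab x; rewrite /from_ref /to_ref; field; rewrite subr_eq0 gt_eqF.
Qed.

Lemma to_refK (R : realType) (a b : R) : a < b ->
  cancel (to_ref a b) (from_ref a b).
Proof.
by move=> ab x; rewrite /from_ref /to_ref; field; rewrite subr_eq0 gt_eqF.
Qed.

Lemma from_refN1 (R : realType) (a b : R) : from_ref a b (-1) = a.
Proof. by rewrite /from_ref; field. Qed.

Lemma from_ref1 (R : realType) (a b : R) : from_ref a b 1 = b.
Proof. by rewrite /from_ref; field. Qed.

Lemma ltr_from_ref (R : realType) (a b : R) : a < b ->
  {mono from_ref a b : x y / x < y}.
Proof.
move=> ab x y; rewrite /from_ref ltr_pM2r// ltrD2l ltr_pM2l// subr_gt0//.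
Qed.

Lemma comp_to_ref_from_ref (R : realType) (a b : R) : a < b ->
  to_ref_poly a b \Po from_ref_poly a b = 'X.
Proof.
move=> ab; rewrite /to_ref_poly /from_ref_poly comp_polyB comp_polyZ comp_polyX
  comp_polyC.
rewrite scalerDr scalerA -[in X in X - _]mul_polyC -mul_polyC -addrA -!polyCM
  -polyCB.
have ba : b - a != 0 by rewrite subr_eq0 gt_eqF.
rewrite (_ : 2 / (b - a) * ((b - a) / 2) = 1); last by field.
rewrite (_ : _ - _ = 0); last by field.
by rewrite mul1r addr0.
Qed.

Section JetFromRef.
Context {R : realType} (a b : R).

Lemma from_ref_right : a < b -> from_ref a b x @[x --> (-1)^'+] --> a^'+.
Proof.
move=> ab P aP.
have c1 : from_ref a b @ nbhs (-1 : R) --> nbhs (a : R).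
  have <- : horner (from_ref_poly a b) = from_ref a b.
    by apply/funext => x; rewrite horner_from_ref_poly.
  by have := @continuous_horner R (from_ref_poly a b) (-1); rewrite
    /continuous_at horner_from_ref_poly from_refN1.
have H : \forall x \near (-1 : R), a < from_ref a b x -> P (from_ref a b x).
  exact: c1 _ aP.
change (\forall x \near (-1 : R)^'+, P (from_ref a b x)); near=> x.
have Hx : a < from_ref a b x -> P (from_ref a b x).
  by near: x; exact: cvg_within H.
apply: Hx; rewrite -{1}(from_refN1 a b) ltr_from_ref//.
Unshelve. all: by end_near. Qed.

Lemma from_ref_left : a < b -> from_ref a b x @[x --> (1 : R)^'-] --> b^'-.
Proof.
move=> ab P aP.
have c1 : from_ref a b @ nbhs (1 : R) --> nbhs (b : R).
  have <- : horner (from_ref_poly a b) = from_ref a b.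
    by apply/funext => x; rewrite horner_from_ref_poly.
  by have := @continuous_horner R (from_ref_poly a b) 1; rewrite /continuous_at
    horner_from_ref_poly from_ref1.
have H : \forall x \near (1 : R), from_ref a b x < b -> P (from_ref a b x).
  exact: c1 _ aP.
change (\forall x \near (1 : R)^'-, P (from_ref a b x)); near=> x.
have Hx : from_ref a b x < b -> P (from_ref a b x).
  by near: x; exact: cvg_within H.
apply: Hx; rewrite -{2}(from_ref1 a b) ltr_from_ref//.
Unshelve. all: by end_near. Qed.

Lemma jet_from_ref (c : R) (G G' : set_system R) m f p :
  one_sided c G' -> from_ref a b x @[x --> G'] --> G ->
  jet G m f (pjet p (from_ref a b c)) ->
  jet G' m (f \o from_ref a b) (pjet (p \Po from_ref_poly a b) c).
Proof.
move=> hG' fG; have [GP _ _] := hG'.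
have fG' (P : set R) : G P -> G' (fun x => P (from_ref a b x)) by exact: fG.
have dfr x : derivable (from_ref a b) x 1.
  rewrite (_ : from_ref a b = horner (from_ref_poly a b)); first exact:
    derivable_horner.
  by apply/funext => y; rewrite horner_from_ref_poly.
elim: m f p => [//|m IH] f p [fs df jf]; split.
- rewrite /pjet derivn0 horner_comp horner_from_ref_poly; apply: cvg_comp fG _.
  by move: fs; rewrite /pjet derivn0.
- move=> m0; apply: filterS (fG' _ (df m0)) => x fx.
  apply/derivable1_diffP; apply: differentiable_comp; apply/derivable1_diffP.
    exact: dfr.
  exact: fx.
- case: m IH df jf => [//|m] IH df jf.
  have j1 : jet G m.+1 (derive1 f) (pjet p^`() (from_ref a b c)).
    suff -> : pjet p^`() (from_ref a b c) = pjet p (from_ref a b c) \o succn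
      by [].
    by apply/funext => i; rewrite /comp pjetS.
  have := jetM hG' (IH _ _ j1) (jet_horner hG' m.+1 (from_ref_poly a b)^`()).
  apply: (jet_ext hG'); last first.
    by move=> i _; rewrite /comp pjetS deriv_comp.
  apply: filterS (fG' _ (df isT)) => x fx.
  have E : from_ref a b = horner (from_ref_poly a b).
    by apply/funext => y; rewrite horner_from_ref_poly.
  by rewrite (derive1_comp (dfr x) fx) E -derivE.
Qed.

End JetFromRef.

(** * Jets of vector-valued functions *)

Definition vjet (R : realType) (d : nat) (G : set_system R) (m : nat)
    (f : R -> 'cV[R]_d) (s : nat -> 'cV[R]_d) : Prop :=
  forall l, jet G m (fun x => f x l ord0) (fun i => s i l ord0).

Definition vpjet (R : realType) (d : nat) (p : 'cV[{poly R}]_d) (c : R)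
    (i : nat) : 'cV[R]_d := \col_l pjet (p l ord0) c i.

Lemma cvg_coord (R : realType) (d : nat) (G : set_system R) (f : R -> 'cV[R]_d)
    (v : 'cV[R]_d) : Filter G ->
  (forall l, f x l ord0 @[x --> G] --> v l ord0) -> f x @[x --> G] --> v.
Proof.
move=> FG h; apply/cvgrPdist_le => /= e e0; near=> x.
rewrite /Num.Def.normr/= mx_normrE (bigmax_le _ (ltW e0))//= => -[i j] _.
rewrite !mxE/= (ord1 j).
move: i; near: x; apply: filter_forall => /= i.
exact: ((cvgrPdist_le _ _).1 (h i)).
Unshelve. all: by end_near. Qed.

Lemma derivable_coord (R : realType) (d : nat) (f : R -> 'cV[R]_d) (x : R) :
  (forall l, derivable (fun x => f x l ord0) x 1) ->
  derivable f x 1 /\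
  forall l, derive1 f x l ord0 = derive1 (fun x => f x l ord0) x.
Proof.
move=> h; have fx : derivable f x 1.
  by apply/derivable_mxP => i j; rewrite (ord1 j); exact: h.
by split=> // l; rewrite !derive1E derive_mx// mxE.
Qed.

Section VJets.
Context {R : realType} (d : nat) (c : R) (G : set_system R).
Context (hG : one_sided c G).
Implicit Types (f g : R -> 'cV[R]_d) (s : nat -> 'cV[R]_d).

Let GP : ProperFilter G. Proof. by case: hG. Qed.
Local Existing Instance GP.

Lemma vjet_ext m f g s s' : (\forall x \near G, f x = g x) ->
  (forall i, (i < m)%N -> s i = s' i) -> vjet G m f s -> vjet G m g s'.
Proof.
move=> fg ss' jf l; apply: (jet_ext hG) (jf l).
  by apply: filterS fg => x ->.
by move=> i im; rewrite ss'.
Qed.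

Lemma vjet_mono m m' f s : (m' <= m)%N -> vjet G m f s -> vjet G m' f s.
Proof. by move=> mm jf l; apply: jet_mono mm (jf l). Qed.

Lemma vjet_lim m f s i : vjet G m f s -> (i < m)%N ->
  derive1n i f x @[x --> G] --> s i.
Proof.
elim: i m f s => [|i IH] [//|m] f s jf im.
  by apply: cvg_coord => l; have [] := jf l.
rewrite (_ : derive1n i.+1 f = derive1n i (derive1 f)); last first.
  by rewrite /derive1n iterSr.
apply: (IH m _ (s \o succn)) => // l.
have df : \forall x \near G, forall l, derivable (fun x => f x l ord0) x 1.
  apply: filter_forall => l'; have [_ h _] := jf l'.
  by apply: h; exact: leq_ltn_trans (leq0n i) im.
have [_ _] := jf l; apply: (jet_ext hG) => //.
by apply: filterS df => x /derivable_coord[_ ->].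
Qed.

Lemma vjet_lim_eq m f s i : vjet G m f s -> (i < m)%N ->
  lim (derive1n i f x @[x --> G]) = s i.
Proof. by move=> jf im; apply: cvg_lim => //; exact: vjet_lim im. Qed.

Lemma vjet_vpoly m (p : 'cV[{poly R}]_d) : vjet G m (vpoly p) (vpjet p c).
Proof.
move=> l; apply: (jet_ext hG) (jet_horner hG m (p l ord0)).
  by near=> x; rewrite mxE.
by move=> i _; rewrite mxE.
Unshelve. all: by end_near. Qed.

End VJets.

Section VPoly.
Context {R : realType} (d : nat).
Implicit Types (p q : 'cV[{poly R}]_d) (M : 'M[R]_d).

Lemma derive1_vpoly p x : derive1 (vpoly p) x = vpoly (map_mx deriv p) x.
Proof.
have E l : (fun x => vpoly p x l ord0) = horner (p l ord0).
  by apply/funext => y; rewrite mxE.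
have [|_ h] := @derivable_coord _ _ (vpoly p) x.
  by move=> l; rewrite E; exact: derivable_horner.
by apply/colP => l; rewrite h E -derivE !mxE.
Qed.

Lemma vpjetS p c i : vpjet p c i.+1 = vpjet (map_mx deriv p) c i.
Proof. by apply/colP => l; rewrite !mxE pjetS. Qed.

Lemma vpoly_mulmx M p x : vpoly (map_mx polyC M *m p) x = M *m vpoly p x.
Proof.
apply/colP => l; rewrite !mxE horner_sum; apply: eq_bigr => i _.
by rewrite !mxE hornerM hornerC.
Qed.

Lemma vpjet_mulmx M p c i :
  vpjet (map_mx polyC M *m p) c i = M *m vpjet p c i.
Proof.
apply/colP => l; rewrite !mxE (big_morph (fun u : {poly R} => pjet u c i)
  (id1 := 0) (op1 := +%R)).
- by apply: eq_bigr => j _; rewrite !mxE mul_polyC pjetZ.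
- by move=> p1 p2; exact: pjetD.
- by rewrite -(scale0r 0) pjetZ mul0r.
Qed.

Definition pdot p q : {poly R} := \sum_l p l ord0 * q l ord0.

Lemma horner_pdot p q x : (pdot p q).[x] = dot (vpoly p x) (vpoly q x).
Proof.
by rewrite horner_sum; apply: eq_bigr => l _; rewrite hornerM !mxE.
Qed.

End VPoly.

Lemma jet_dot (R : realType) (d : nat) (c : R) (G : set_system R) m
    (f : R -> 'cV[R]_d) (p q : 'cV[{poly R}]_d) : one_sided c G ->
  vjet G m f (vpjet p c) ->
  jet G m (fun x => dot (f x) (vpoly q x)) (pjet (pdot p q) c).
Proof.
move=> hG jf; apply: (jet_sum hG) => l; apply: (jetM hG).
  have [GP _ _] := hG.
  by apply: (jet_ext hG) (jf l) => [|i _]; [near=> x|rewrite mxE].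
have := jet_horner hG m (q l ord0).
rewrite (_ : horner _ = fun x => vpoly q x l ord0)//.
by apply/funext => x; rewrite mxE.
Unshelve. all: by end_near. Qed.

Lemma ex_vtaylor (R : realType) (d : nat) (c : R) (s : nat -> 'cV[R]_d) m :
  exists p, forall i, (i < m)%N -> vpjet p c i = s i.
Proof.
have /choice[p hp] : forall l, exists p : {poly R},
    forall i, (i < m)%N -> pjet p c i = s i l ord0.
  by move=> l; exact: ex_taylor (fun i => s i l ord0) m.
by exists (\col_l p l) => i im; apply/colP => l; rewrite !mxE hp.
Qed.

(** * The chain rule along polynomial curves *)

Lemma derivable_vpoly (R : realType) (d : nat) (p : 'cV[{poly R}]_d) x :
  derivable (vpoly p) x 1.
Proof.
have [] // := @derivable_coord R d (vpoly p) x.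
move=> l; rewrite (_ : (fun _ => _) = horner (p l ord0)).
  exact: derivable_horner.
by apply/funext => y; rewrite mxE.
Qed.

Section StripJets.
Context {R : realType} (A B : R) (d : nat).
Implicit Types (G : R * 'cV[R]_d -> 'cV[R]_d) (p : 'cV[{poly R}]_d).
Implicit Types (K : R -> (nat -> 'cV[R]_d) -> R).

(** Components of functions G (x, y 0) along a curve generate, under what total
    differentiation produces, the expressions collected here; y 0, y 1, ...
    stand for the derivatives of the curve.  In jetfun j i the functions on the
    strip are C^j, and derivatives of the curve occur up to order i. *)
Inductive jetfun (j i : nat) : (R -> (nat -> 'cV[R]_d) -> R) -> Prop :=
| jetfun_base G l of Cj_strip A B j G :
    jetfun j i (fun x y => G (x, y 0%N) l ord0)
| jetfun_scale K m l of (m <= i)%N & jetfun j i K :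
    jetfun j i (fun x y => y m l ord0 * K x y)
| jetfun_add K K' of jetfun j i K & jetfun j i K' :
    jetfun j i (fun x y => K x y + K' x y)
| jetfun0 : jetfun j i (fun _ _ => 0).

Lemma Cj_strip_weaken j G : Cj_strip A B j.+1 G -> Cj_strip A B j G.
Proof.
elim: j G => [|j IH] G; first by case.
move=> [cG [dG DG]]; split=> //; split=> // v.
by have [g gj gE] := DG v; exists g => //; exact: IH.
Qed.

Lemma jetfun_weaken j i K : jetfun j.+1 i K -> jetfun j i K.
Proof.
elim=> {K} [G l /Cj_strip_weaken|K m l mi _|K K' _ IH _|]; try by constructor.
Qed.

Lemma jetfun_leq_order j i K : jetfun j i K -> jetfun j i.+1 K.
Proof.
elim=> {K} [G l Gj|K m l mi _|K K' _ IH _ IH'|]; constructor => //.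
exact: leqW.
Qed.

Lemma jetfun_sum j i (K : 'I_d -> R -> (nat -> 'cV[R]_d) -> R) :
  (forall m, jetfun j i (K m)) -> jetfun j i (fun x y => \sum_m K m x y).
Proof.
move=> h; elim: (index_enum _) => [|m r IH].
  rewrite (_ : (fun _ _ => _) = (fun _ _ => 0)); first exact: jetfun0.
  by apply/funext => x; apply/funext => y; rewrite big_nil.
rewrite (_ : (fun _ _ => _) = fun x y => K m x y + \sum_(m <- r) K m x y).
  exact: jetfun_add.
by apply/funext => x; apply/funext => y; rewrite big_cons.
Qed.

Lemma jetfun_dep j i K x y y' : jetfun j i K ->
  (forall m, (m <= i)%N -> y m = y' m) -> K x y = K x y'.
Proof.
move=> jK yy'; elim: jK => {K} [G l _|K m l mi _ IH|K K' _ IH _ IH'|] //.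
- by rewrite yy'.
- by rewrite yy'// IH.
- by rewrite IH IH'.
Qed.

(** The tangent vector (1, p' x) is split into fixed directions because
    Cj_strip extends derivatives to the closed strip one fixed direction at a
    time. *)
Lemma derive1_along_curve G p x : differentiable G (x, vpoly p x) ->
  derivable (fun x => G (x, vpoly p x)) x 1 /\
  derive1 (fun x => G (x, vpoly p x)) x
  = 'D_(1, 0) G (x, vpoly p x)
    + \sum_m vpoly (map_mx deriv p) x m ord0
        *: 'D_(0, delta_mx m ord0) G (x, vpoly p x).
Proof.
move=> dG.
have dp : differentiable (vpoly p) x by exact/derivable1_diffP/derivable_vpoly.
have di : differentiable (id : R -> R) x by [].
have dpsi : differentiable (fun x => (id x, vpoly p x)) x.
  exact: differentiable_pair.
split.
  by apply/derivable1_diffP; apply: (differentiable_comp dpsi).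
rewrite derive1E (deriveE _ (differentiable_comp dpsi dG)) (diff_comp dpsi dG)
  /=.
rewrite (diff_pair di dp) -(deriveE _ di) -(deriveE _ dp) derive_id -derive1E.
rewrite derive1_vpoly deriveE//; under eq_bigr do rewrite deriveE//.
under eq_bigr do rewrite -linearZ.
rewrite -linear_sum -linearD; congr ('d _ _ _).
set v := vpoly _ x.
have -> : \sum_i v i ord0 *: ((0, delta_mx i ord0) : R * 'cV[R]_d) = (0, v).
  rewrite [LHS]surjective_pairing; congr (_, _).
    by rewrite raddf_sum big1// => i _ /=; rewrite scaler0.
  rewrite raddf_sum /= [RHS]matrix_sum_delta.
  by apply: eq_bigr => i _; rewrite big_ord1.
by apply/eqP; rewrite xpair_eqE /= addr0 add0r !eqxx.
Qed.

(** Total differentiation costs one order of smoothness and brings in one more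
    derivative of the curve. *)
Lemma jetfun_deriv j i K : jetfun j.+1 i K -> exists2 K', jetfun j i.+1 K' &
  forall p x, A < x < B ->
    is_derive x 1 (fun x => K x (vpjet p x)) (K' x (vpjet p x)).
Proof.
elim=> {K} [G l [cG [dG DG]]|K m l mi jK [K' jK' dK]
           |K L _ [K' jK' dK] _ [L' jL' dL]|].
- have [g0 jg0 g0E] := DG (1, 0).
  have /choice[g hg] : forall m : 'I_d, exists g, Cj_strip A B j g /\
      forall z, A < z.1 < B -> 'D_(0, delta_mx m ord0) G z = g z.
    by move=> m; have [g] := DG (0, delta_mx m ord0); exists g.
  exists (fun x (y : nat -> 'cV[R]_d) => g0 (x, y 0%N) l ord0
            + \sum_m y 1%N m ord0 * g m (x, y 0%N) l ord0).
    apply: jetfun_add; first exact: jetfun_base.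
    apply: jetfun_sum => m; apply: jetfun_scale => //.
    by apply: jetfun_base; have [] := hg m.
  move=> p x xAB.
  have E z : vpjet p z 0 = vpoly p z.
    by apply/colP => n; rewrite !mxE /pjet derivn0.
  have [h1 h2] := derive1_along_curve (dG (x, vpoly p x) xAB).
  have {}h1 : forall l, derivable (fun x => G (x, vpoly p x) l ord0) x 1.
    by move=> l'; move/derivable_mxP : h1; exact.
  have [_ h3] := derivable_coord h1.
  rewrite (_ : (fun z => _) = (fun x => G (x, vpoly p x) l ord0)); last first.
    by apply/funext => z; rewrite E.
  apply: DeriveDef; first exact: h1.
  rewrite -derive1E -h3 h2 mxE summxE E g0E//; congr (_ + _).
  apply: eq_bigr => m _; have [_ gE] := hg m.
  by rewrite mxE gE// vpjetS /vpjet !mxE /pjet derivn0.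
- exists (fun x (y : nat -> 'cV[R]_d) => y m l ord0 * K' x y + y m.+1 l ord0 * K
  x y).
    apply: jetfun_add; first by apply: jetfun_scale => //; exact: leqW.
    by apply: jetfun_scale => //; exact/jetfun_leq_order/jetfun_weaken.
  move=> p x xAB; have dKx := dK p x xAB.
  have dy : is_derive x 1 (fun x => vpjet p x m l ord0) (vpjet p x m.+1 l ord0).
    rewrite (_ : (fun _ => _) = horner (derivn m (p l ord0))).
      by rewrite mxE /pjet; exact: is_derive_poly.
    by apply/funext => z; rewrite mxE.
  apply: is_derive_eq.
  by rewrite /GRing.scale /= [_ * (vpjet _ _ _ _ _)]mulrC.
- exists (fun x (y : nat -> 'cV[R]_d) => K' x y + L' x y); first exact:
  jetfun_add.
  move=> p x xAB; have dKx := dK p x xAB; have dLx := dL p x xAB.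
  exact: is_deriveD.
- exists (fun _ _ => 0); first exact: jetfun0.
  by move=> p x _; exact: is_derive_cst.
Qed.

Section AtPoint.
Context (c : R) (Gf : set_system R).
Context (hGf : one_sided c Gf) (cAB : A <= c <= B).
Context (nAB : \forall x \near Gf, A < x < B).

Let GP : ProperFilter Gf. Proof. by case: hGf. Qed.
Local Existing Instance GP.

Lemma cvg_one_sided (p : {poly R}) : p.[x] @[x --> Gf] --> p.[c].
Proof. by have [] := jet_horner hGf 1 p. Qed.

(** If c is an end point of [A, B], continuity relative to the strip is all
    that Cj_strip gives, so the curve has to approach c from inside it. *)
Lemma jetfun_cvg j i K p : jetfun j i K ->
  K x (vpjet p x) @[x --> Gf] --> K c (vpjet p c).
Proof.
elim=> {K} [G l jG|K m l mi _ IH|K K' _ IH _ IH'|].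
- have cG : {within [set z : R * 'cV[R]_d | A <= z.1 <= B], continuous G}.
    by case: (j) jG => [|j'] [].
  have /subspace_continuousP/(_ (c, vpjet p c 0%N) cAB) := cG.
  move=> cGc; have /= cl := @coord_continuous R _ _ l ord0
    (G (c, vpjet p c 0%N)).
  apply: (@cvg_comp _ _ _ (fun x => G (x, vpjet p x 0%N)) (fun M => M l ord0) Gf
    (nbhs (G (c, vpjet p c 0%N)))) => //.
  apply: (cvg_comp (fun x => (x, vpjet p x 0%N)) G) cGc.
  have cpsi : (x, vpjet p x 0%N) @[x --> Gf] --> (c, vpjet p c 0%N).
    have c1 : id x @[x --> Gf] --> nbhs c by have [] := hGf.
    have c2 : vpjet p x 0%N @[x --> Gf] --> nbhs (vpjet p c 0%N).
      apply: cvg_coord => l'; rewrite mxE.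
      rewrite (_ : (fun _ => _) = horner (derivn 0 (p l' ord0))).
        exact: cvg_one_sided.
      by apply/funext => z; rewrite mxE.
    exact: cvg_pair c1 c2.
  move=> P wP; have := cpsi _ wP.
  rewrite /fmap /= => h; near=> x.
  have : A < x < B by near: x.
  move=> /andP[Ax xB].
  suff : A <= (x, vpjet p x 0%N).1 <= B -> P (x, vpjet p x 0%N).
    by apply; rewrite /= !ltW.
  by near: x.
- apply: cvgM => //.
  rewrite mxE (_ : (fun _ => _) = horner (derivn m (p l ord0))).
    exact: cvg_one_sided.
  by apply/funext => z; rewrite mxE.
- exact: cvgD.
- exact: cvg_cst.
Unshelve. all: by end_near. Qed.

End AtPoint.

Lemma jetfun_jet j i K : jetfun j i K ->
  exists2 Ks : nat -> R -> (nat -> 'cV[R]_d) -> R,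
    forall n x y y', (forall m, (m <= i + n)%N -> y m = y' m) ->
      Ks n x y = Ks n x y' &
    forall (c : R) (Gf : set_system R) p, one_sided c Gf -> A <= c <= B ->
      (\forall x \near Gf, A < x < B) ->
      jet Gf j.+1 (fun x => K x (vpjet p x)) (fun n => Ks n c (vpjet p c)).
Proof.
elim: j i K => [|j IH] i K jK.
  exists (fun _ => K).
    move=> n x y y' yy'; apply: (jetfun_dep _ jK) => m mi.
    by apply: yy'; exact: leq_trans (leq_addr _ _).
  move=> c Gf p hGf cAB nAB; split=> //; exact: jetfun_cvg jK.
have [K' /IH[Ks' dKs' jKs'] dK'] := jetfun_deriv jK.
exists (fun n => if n is n'.+1 then Ks' n' else K).
  move=> [|n] x y y' yy'.
    by apply: (jetfun_dep _ jK) => m mi; apply: yy'; rewrite addn0.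
  by apply: dKs' => m mi; apply: yy'; rewrite addnS -addSn.
move=> c Gf p hGf cAB nAB; have [GP _ _] := hGf; split.
- exact: jetfun_cvg jK.
- by move=> _; apply: filterS nAB => x /(dK' p)[].
- apply: (jet_ext hGf) (jKs' c Gf p hGf cAB nAB) => //.
  by apply: filterS nAB => x /(dK' p)[? <-]; rewrite derive1E.
Qed.

(** K n c y is the n-th total derivative of x |-> G (x, y x) at c, as a function
    of the derivatives y i of the curve at c.  The same K n serves both
    sides of c and all curves; this is what allows one-sided derivatives on
    neighbouring intervals to be compared. *)
Lemma total_derivatives j G : Cj_strip A B j G ->
  exists2 K : nat -> R -> (nat -> 'cV[R]_d) -> 'cV[R]_d,
    forall n x y y', (forall m, (m <= n)%N -> y m = y' m) ->
      K n x y = K n x y' &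
    forall (c : R) (Gf : set_system R) p, one_sided c Gf -> A <= c <= B ->
      (\forall x \near Gf, A < x < B) ->
      vjet Gf j.+1 (fun x => G (x, vpoly p x)) (fun n => K n c (vpjet p c)).
Proof.
move=> jG; pose Kl l := cid2 (jetfun_jet (jetfun_base 0 l jG)).
exists (fun n x y => \col_l s2val (Kl l) n x y).
  move=> n x y y' yy'; apply/colP => l; rewrite !mxE.
  exact: (s2valP (Kl l)).
move=> c Gf p hGf cAB nAB l; have [GP _ _] := hGf.
apply: (jet_ext hGf) (s2valP' (Kl l) c Gf p hGf cAB nAB).
  near=> x; suff -> : vpjet p x 0 = vpoly p x by [].
  by apply/colP => n; rewrite !mxE /pjet derivn0.
by move=> n _; rewrite mxE.
Unshelve. all: by end_near. Qed.

End StripJets.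

(** * Integrals of polynomials *)

(** Makes the algebra of pint a matter of evaluating primitives, without any
    integrability side conditions. *)
Lemma ex_antideriv (R : realType) (p : {poly R}) : exists P, P^`() = p.
Proof.
exists (\poly_(i < (size p).+1) (p`_i.-1 / i%:R)).
apply/polyP => i; rewrite coef_deriv coef_poly ltnS /=; case: ltnP => ip.
  by rewrite -(mulr_natr (p`_i / _)) divfK// pnatr_eq0.
by rewrite nth_default// mul0rn.
Qed.

Definition pint (R : realType) (a b : R) (p : {poly R}) : R :=
  \int[lebesgue_measure]_(x in `]a, b]) p.[x].

Section PolyIntegral.
Context {R : realType} (a b : R) (ab : a < b).
Implicit Types p q : {poly R}.

Lemma Rintegral_itvcc_deriv p :
  \int[lebesgue_measure]_(x in `[a, b]) (p^`()).[x] = p.[b] - p.[a].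
Proof.
rewrite /Rintegral (@continuous_FTC2 _ _ (horner p))//.
- by apply: continuous_subspaceT => x; exact: continuous_horner.
- split; first by move=> x _; exact: derivable_horner.
  + by apply: cvg_at_right_filter; exact: continuous_horner.
  + by apply: cvg_at_left_filter; exact: continuous_horner.
- by move=> x _; rewrite derivE.
Qed.

Lemma Rintegral_itvcc p :
  \int[lebesgue_measure]_(x in `[a, b]) p.[x] = pint a b p.
Proof.
rewrite /pint /Rintegral integral_itv_obnd_cbnd//.
apply/measurable_EFinP; apply: (@measurable_funS _ _ _ _ setT) => //.
by apply: continuous_measurable_fun => x; exact: continuous_horner.
Qed.

Lemma pint_deriv p : pint a b p^`() = p.[b] - p.[a].
Proof. by rewrite -Rintegral_itvcc Rintegral_itvcc_deriv. Qed.

Lemma pintD p q : pint a b (p + q) = pint a b p + pint a b q.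
Proof.
have [P <-] := ex_antideriv p; have [Q <-] := ex_antideriv q.
by rewrite -derivD !pint_deriv !hornerD opprD addrACA.
Qed.

Lemma pintZ c p : pint a b (c *: p) = c * pint a b p.
Proof.
have [P <-] := ex_antideriv p.
by rewrite -derivZ !pint_deriv !hornerZ mulrBr.
Qed.

Lemma pintB p q : pint a b (p - q) = pint a b p - pint a b q.
Proof. by rewrite pintD -scaleN1r pintZ mulN1r. Qed.

(** Otherwise the primitive would be constant on [a, b], and a polynomial with
    infinitely many roots is zero. *)
Lemma pint_gt0 p : p != 0 -> (forall x, a < x < b -> 0 <= p.[x]) ->
  0 < pint a b p.
Proof.
move=> p0 pge0; have [P PE] := ex_antideriv p.
have incP : {in `[a, b]%R &, {homo horner P : x y / x <= y}}.
  apply: ger0_derive1_le_cc.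
  - by move=> x _; exact: derivable_horner.
  - by move=> x; rewrite -derivE PE in_itv /= => /pge0.
  - by apply: continuous_subspaceT => x; exact: continuous_horner.
have aI : a \in `[a, b]%R by rewrite in_itv/= lexx ltW.
have bI : b \in `[a, b]%R by rewrite in_itv/= lexx ltW.
rewrite -PE pint_deriv subr_gt0 lt_neqAle incP ?(ltW ab)// andbT.
apply/eqP => Pab; move/eqP: p0; apply.
have PC x : x \in `[a, b]%R -> P.[x] = P.[a].
  move=> xI; move: (xI); rewrite in_itv /= => /andP[ax xb].
  apply/eqP; rewrite eq_le; apply/andP; split; last exact: incP.
  by rewrite Pab; exact: incP.
have P0 : P - P.[a]%:P = 0.
  pose n := size (P - P.[a]%:P).
  pose rs := [seq a + (b - a) / i.+1%:R | i <- iota 0 n].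
  apply/eqP/negPn/negP => /(@max_poly_roots _ _ rs).
  rewrite size_map size_iota ltnn => h; suff : false by [].
  apply: h.
    apply/allP => _ /mapP[i _ ->]; rewrite rootE !hornerE PC ?subrr//.
    rewrite in_itv /= lerDl divr_ge0 ?subr_ge0 ?(ltW ab)//=.
    by rewrite -lerBrDl ler_pdivrMr// ler_peMr ?subr_ge0 ?(ltW ab)// ler1n.
  have ba0 : b - a != 0 by rewrite subr_eq0 gt_eqF.
  rewrite map_inj_uniq ?iota_uniq// => i j /addrI/(mulfI ba0)/invr_inj/eqP.
  by rewrite eqr_nat => /eqP[].
by rewrite -PE -(subrK P.[a]%:P P) P0 add0r derivC.
Qed.

End PolyIntegral.

Lemma pint_from_ref (R : realType) (a b : R) (p : {poly R}) : a < b ->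
  pint a b p = (b - a) / 2 * pint (-1) 1 (p \Po from_ref_poly a b).
Proof.
move=> ab; have n11 : (-1 : R) < 1 by lra.
have [P <-] := ex_antideriv p.
rewrite pint_deriv// -pintZ//.
rewrite (_ : _ *: _ = (P \Po from_ref_poly a b)^`()).
  by rewrite pint_deriv// !horner_comp !horner_from_ref_poly from_ref1
    from_refN1.
rewrite deriv_comp (_ : (from_ref_poly a b)^`() = ((b - a) / 2)%:P).
  by rewrite [RHS]mulrC mul_polyC.
by rewrite /from_ref_poly derivD derivC derivZ derivX addr0 alg_polyC.
Qed.

(** * The quadrature rule *)

Lemma mult_leftD_right k : (mult_left k + mult_right k = k.+1)%N.
Proof.
by rewrite /mult_left /mult_right addnS uphalf_half -addnA addnn
  odd_double_half.
Qed.

Lemma mult_left_le_right k : (mult_left k <= mult_right k)%N.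
Proof.
by rewrite /mult_left /mult_right uphalf_half -add1n leq_add2r leq_b1.
Qed.

Lemma size_affine (R : realType) (c e : R) : c != 0 ->
  size (c *: 'X + e%:P) = 2.
Proof.
by move=> c0; rewrite -mul_polyC size_MXaddC polyC_eq0 (negPf c0) size_polyC c0.
Qed.

Section Quadrature.
Context {R : realType} (r k : nat) (th : 'I_(r - k) -> R) (hkr : (k <= r)%N).
Context (P : {poly R}) (hP : is_jacobi (r - k) (mult_left k) (mult_right k) P).
Context (th_inj : injective th).
Context (hroot : forall i, -1 < th i < 1 /\ root P (th i)).

Let L := mult_left k.
Let Rr := mult_right k.

Section Interval.
Context (a b : R) (ab : a < b).

Let ba0 : b - a != 0. Proof. by rewrite subr_eq0 gt_eqF. Qed.

(** The Jacobi polynomial of the rule, transported to [a, b]. *)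
Definition interior_poly : {poly R} := P \Po to_ref_poly a b.
(** Has the quadrature points as roots, with their multiplicities. *)
Definition nodal_poly : {poly R} :=
  ('X - a%:P) ^+ mult_left k * ('X - b%:P) ^+ mult_right k * interior_poly.
Local Notation Nd := interior_poly.
Local Notation J := nodal_poly.

Lemma size_to_ref_poly : size (to_ref_poly a b) = 2.
Proof.
by rewrite /to_ref_poly -polyCN size_affine// mulf_neq0 ?invr_eq0 ?pnatr_eq0.
Qed.

Lemma size_from_ref_poly : size (from_ref_poly a b) = 2.
Proof.
by rewrite /from_ref_poly size_affine// mulf_neq0 ?invr_eq0 ?pnatr_eq0.
Qed.

Lemma size_interior_poly : size Nd = (r - k).+1.
Proof. by rewrite size_comp_poly2 ?size_to_ref_poly//; case: hP. Qed.

Lemma interior_poly_neq0 : Nd != 0.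
Proof. by rewrite -size_poly_gt0 size_interior_poly. Qed.

Lemma root_interior_poly i : Nd.[from_ref a b (th i)] = 0.
Proof.
rewrite horner_comp horner_to_ref_poly// from_refK//; apply/eqP.
by have [] := hroot i.
Qed.

Lemma from_ref_in x : -1 < x < 1 -> a < from_ref a b x < b.
Proof.
move=> /andP[x1 x2]; rewrite -{1}(from_refN1 a b) -{4}(from_ref1 a b).
by rewrite !ltr_from_ref// x1 x2.
Qed.

Let nodes := [seq from_ref a b (th i) | i <- enum 'I_(r - k)].

Lemma interior_poly_prod : Nd %= \prod_(z <- nodes) ('X - z%:P).
Proof.
have ru : uniq_roots nodes.
  rewrite uniq_rootsE map_inj_uniq ?enum_uniq//.
  exact: inj_comp (can_inj (from_refK ab)) th_inj.
rewrite {1}(@all_roots_prod_XsubC _ Nd nodes)//.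
- by rewrite eqp_scale// lead_coef_eq0 interior_poly_neq0.
- by rewrite size_interior_poly size_map size_enum_ord.
- by apply/allP => _ /mapP[i _ ->]; rewrite rootE root_interior_poly.
Qed.

Lemma interior_poly_dvdp (p : {poly R}) :
  (forall i, root p (from_ref a b (th i))) -> Nd %| p.
Proof.
move=> h; rewrite (eqp_dvdl _ interior_poly_prod); apply: uniq_roots_dvdp.
  by apply/allP => _ /mapP[i _ ->].
rewrite uniq_rootsE map_inj_uniq ?enum_uniq//.
exact: inj_comp (can_inj (from_refK ab)) th_inj.
Qed.

Lemma root_interior_polyN x : ~~ (a < x < b) -> ~~ root Nd x.
Proof.
apply: contra; rewrite (eqp_root interior_poly_prod) root_prod_XsubC.
by move=> /mapP[i _ ->]; apply: from_ref_in; have [] := hroot i.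
Qed.

(** The three factors of the nodal polynomial are coprime, because the interior
    nodes are different from the end points. *)
Lemma nodal_poly_dvdp (p : {poly R}) :
  ('X - a%:P) ^+ L %| p -> ('X - b%:P) ^+ Rr %| p ->
  (forall i, root p (from_ref a b (th i))) -> J %| p.
Proof.
move=> pa pb pn; rewrite Gauss_dvdp.
  rewrite Gauss_dvdp ?pa ?pb ?interior_poly_dvdp//.
  by rewrite coprimep_expl// coprimep_expr// coprimep_XsubC2 ?subr_eq0 ?gt_eqF.
rewrite coprimep_sym coprimepMr !coprimep_expr// coprimep_XsubC.
  by rewrite root_interior_polyN// ltxx andbF.
by rewrite root_interior_polyN// ltxx.
Qed.

Lemma size_nodal_poly : size J = r.+2.
Proof.
have X0 (c : R) m : ('X - c%:P) ^+ m != 0 by rewrite expf_neq0 ?polyXsubC_eq0.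
rewrite /nodal_poly !size_mul ?mulf_neq0 ?interior_poly_neq0//.
rewrite !size_exp_XsubC size_interior_poly.
have := mult_leftD_right k; lia.
Qed.

Lemma nodal_poly_neq0 : J != 0.
Proof. by rewrite -size_poly_gt0 size_nodal_poly. Qed.

(** On the reference interval this is the orthogonality that defines the Jacobi
    polynomial, up to powers of the Jacobian (b - a) / 2. *)
Lemma nodal_poly_orth (q : {poly R}) : (size q <= r - k)%N ->
  pint a b (J * q) = 0.
Proof.
move=> sq; rewrite pint_from_ref//.
have [_ orth] := hP; have := orth (q \Po from_ref_poly a b).
have n11 : (-1 : R) < 1 by lra.
rewrite size_comp_poly2 ?size_from_ref_poly// => /(_ sq).
rewrite (_ : (fun x => _) = horner
  ((1 + 'X) ^+ L * (1 - 'X) ^+ Rr * P * (q \Po from_ref_poly a b))).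
  rewrite Rintegral_itvcc// => h.
  pose u := (b - a) / 2.
  rewrite (_ : (J * q) \Po from_ref_poly a b = (u ^+ L * (- u) ^+ Rr)
     *: ((1 + 'X) ^+ L * (1 - 'X) ^+ Rr * P * (q \Po from_ref_poly a b))).
    by rewrite pintZ// h !mulr0.
  rewrite /nodal_poly /interior_poly !comp_polyM !rmorphXn /= !comp_polyB
    !comp_polyX !comp_polyC.
  rewrite -comp_polyA comp_to_ref_from_ref// comp_polyXr.
  have -> : from_ref_poly a b - a%:P = u%:P * (1 + 'X).
    rewrite /from_ref_poly -/u -mul_polyC mulrDr mulr1 addrAC -addrA -polyCN
      -polyCD addrC.
    by congr (_%:P + _); rewrite /u; field.
  have -> : from_ref_poly a b - b%:P = (- u)%:P * (1 - 'X).
    rewrite /from_ref_poly -/u -mul_polyC mulrBr mulr1 -addrA -polyCN -polyCD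
      addrC polyCN mulNr opprK.
    by rewrite -polyCN; congr (_%:P + _); rewrite /u; field.
  move: (u) => {}u; rewrite !exprMn -mul_polyC polyCM !polyC_exp polyCN.
  by ring.
by apply/funext => x; rewrite !(hornerE, horner_exp).
Qed.

End Interval.

(** The difference of two solutions has degree <= r and is divisible by the
    nodal polynomial, of degree r + 1. *)
Lemma hermite_uniq f p q : hermite_conditions th f p ->
  hermite_conditions th f q -> p = q.
Proof.
move=> [sp p1 p2 p3] [sq q1 q2 q3].
have n11 : (-1 : R) < 1 by lra.
apply/eqP; rewrite -subr_eq0; apply/negPn/negP => pq0.
have := nodal_poly_dvdp n11 (p := p - q).
have -> : nodal_poly (-1) 1 %| p - q = false.
  apply/negP => /(dvdp_leq pq0); rewrite size_nodal_poly//.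
  rewrite leqNgt ltnS (leq_trans (size_polyD _ _))// size_polyN.
  by rewrite geq_max sp sq.
move=> h; suff : false by [].
apply: h.
- by apply/dvdpB_pjet => i iL; rewrite /pjet p1 ?q1.
- by apply/dvdpB_pjet => i iR; rewrite /pjet p2 ?q2.
- move=> i; rewrite (_ : from_ref _ _ _ = th i) ?rootE ?hornerD ?hornerN ?p3 ?q3
  ?subrr//.
  by rewrite /from_ref; field.
Qed.

Lemma hermite_jet f (p : {poly R}) : (size p <= r.+1)%N ->
  jet (-1)^'+ L f (pjet p (-1)) -> jet 1^'- Rr f (pjet p 1) ->
  (forall i, p.[th i] = f (th i)) -> hermite th f = p.
Proof.
move=> sp j1 j2 h; have hp : hermite_conditions th f p.
  split=> // i iL; rewrite -/(pjet _ _ _); apply/esym/cvg_lim => //.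
    exact: jet_lim j1 iL.
  exact: jet_lim j2 iL.
by apply: xget_unique => // q /hermite_uniq; exact.
Qed.

Section Rule.
Context (t : nat -> R) (n : nat).
Let a := t n.-1.
Let b := t n.
Context (ab : a < b).
Local Notation Nd := (interior_poly a b).
Local Notation J := (nodal_poly a b).

Lemma Qrk_jet f (p : {poly R}) : (size p <= r.+1)%N ->
  jet a^'+ L f (pjet p a) -> jet b^'- Rr f (pjet p b) ->
  (forall i, f (from_ref a b (th i)) = p.[from_ref a b (th i)]) ->
  Qrk t th n f = pint a b p.
Proof.
move=> sp ja jb jn; rewrite /Qrk -/a -/b.
rewrite (@hermite_jet _ (p \Po from_ref_poly a b)).
- rewrite /pint; apply: eq_Rintegral => x _ /=.
  by rewrite horner_comp horner_from_ref_poly to_refK.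
- by rewrite size_comp_poly2// size_from_ref_poly.
- apply: (jet_from_ref (one_sided_right _) (from_ref_right ab)).
  by rewrite from_refN1.
- apply: (jet_from_ref (one_sided_left _) (from_ref_left ab)).
  by rewrite from_ref1.
- by move=> i; rewrite horner_comp horner_from_ref_poly -jn.
Qed.

(** The rule sees a function only through its Hermite data. *)
Lemma Qrk_ext f g p q :
  jet a^'+ L f (pjet p a) -> jet b^'- Rr f (pjet q b) ->
  jet a^'+ L g (pjet p a) -> jet b^'- Rr g (pjet q b) ->
  (forall i, f (from_ref a b (th i)) = g (from_ref a b (th i))) ->
  Qrk t th n f = Qrk t th n g.
Proof.
move=> fa fb ga gb fg; rewrite /Qrk -/a -/b.
have dl := jet_from_ref (one_sided_right (-1)) (from_ref_right ab).
have dr := jet_from_ref (one_sided_left 1) (from_ref_left ab).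
rewrite from_refN1 in dl; rewrite from_ref1 in dr.
suff -> : hermite th (f \o from_ref a b) = hermite th (g \o from_ref a b) by [].
rewrite /hermite; congr (xget _ _); apply/seteqP; split=> u [su u1 u2 u3].
- split=> //= [i iL|i iR|i]; last by rewrite u3 /= fg.
  + rewrite u1// /right_lim (cvg_lim _ (jet_lim (dl _ _ _ fa) iL))//.
    by rewrite (cvg_lim _ (jet_lim (dl _ _ _ ga) iL)).
  + rewrite u2// /left_lim (cvg_lim _ (jet_lim (dr _ _ _ fb) iR))//.
    by rewrite (cvg_lim _ (jet_lim (dr _ _ _ gb) iR)).
- split=> //= [i iL|i iR|i]; last by rewrite u3 /= fg.
  + rewrite u1// /right_lim (cvg_lim _ (jet_lim (dl _ _ _ ga) iL))//.
    by rewrite (cvg_lim _ (jet_lim (dl _ _ _ fa) iL)).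
  + rewrite u2// /left_lim (cvg_lim _ (jet_lim (dr _ _ _ gb) iR))//.
    by rewrite (cvg_lim _ (jet_lim (dr _ _ _ fb) iR)).
Qed.

Lemma node_in i : a < from_ref a b (th i) < b.
Proof. by apply: from_ref_in => //; have [] := hroot i. Qed.

(** The remainder of p modulo the nodal polynomial interpolates p, and what it
    leaves out is orthogonal to the nodal polynomial. *)
Lemma Qrk_exact f (p : {poly R}) : (size p <= (r + (r - k)).+1)%N ->
  (forall x, a < x < b -> f x = p.[x]) -> Qrk t th n f = pint a b p.
Proof.
move=> sp fp; have J0 := nodal_poly_neq0 ab.
have pE : p = p %/ J * J + p %% J by exact: divp_eq.
have dpJ c m : ('X - c%:P) ^+ m %| J -> ('X - c%:P) ^+ m %| p - p %% J.
  by move=> h; rewrite {1}pE addrK dvdp_mull.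
have -> : pint a b p = pint a b (p %% J).
  rewrite [in LHS]pE pintD// mulrC nodal_poly_orth ?add0r//.
  by rewrite size_divp// size_nodal_poly// leq_subLR (leq_trans sp)// addSn.
apply: Qrk_jet.
- by have := ltn_modp p J; rewrite J0 size_nodal_poly.
- apply: (jet_ext (one_sided_right a)) (jet_horner (one_sided_right a) L p).
    by apply: filterS (near_right_oo ab) => x /fp ->.
  by apply/dvdpB_pjet/dpJ; rewrite /nodal_poly -mulrA dvdp_mulr.
- apply: (jet_ext (one_sided_left b)) (jet_horner (one_sided_left b) Rr p).
    by apply: filterS (near_left_oo ab) => x /fp ->.
  by apply/dvdpB_pjet/dpJ; rewrite /nodal_poly mulrAC dvdp_mull.
- move=> i; rewrite fp ?node_in// [in LHS]pE hornerD hornerM.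
  by rewrite /nodal_poly hornerM root_interior_poly// !mulr0 add0r.
Qed.

(** Integration by parts leaves the boundary values of theta * psi, since theta
    is a scalar multiple of the nodal polynomial and therefore orthogonal to
    psi'.  The value at b vanishes.  So does the value at a if k > 0; for k = 0
    the point a is not a node, and theta is normalized to 1 there. *)
Lemma pint_bubble (theta psi : {poly R}) : (size theta <= r.+2)%N ->
  vanishes_at_nodes th a b theta -> (derivn L theta).[a] = 1 ->
  (size psi <= (r - k).+1)%N ->
  pint a b (theta^`() * psi) = - (k == 0%N)%:R * psi.[a].
Proof.
move=> st [va vb vn] t1 spsi.
have [z zE] : exists z : R, theta = z *: J.
  have /dvdpP[q qE] := nodal_poly_dvdp ab va vb vn.
  have [q0|q0] := eqVneq q 0; first by exists 0; rewrite qE q0 mul0r scale0r.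
  exists q`_0; rewrite qE -mul_polyC; congr (_ * _); apply: size1_polyC.
  move: st; rewrite qE size_mul ?nodal_poly_neq0// size_nodal_poly//.
  by rewrite addnS /= -[r.+2]add1n leq_add2r.
have -> : theta^`() * psi = (theta * psi)^`() - theta * psi^`().
  by rewrite derivM addrK.
rewrite pintB// pint_deriv// {3}zE -scalerAl pintZ// nodal_poly_orth//; last
  first.
  have [->|p0] := eqVneq psi 0; first by rewrite deriv0 size_poly0.
  by rewrite -ltnS (leq_trans (lt_size_deriv p0)).
have tb : theta.[b] = 0.
  by have := @pjet_dvdp _ b theta _ 0%N vb isT; rewrite /pjet derivn0.
rewrite mulr0 subr0 !hornerM tb mul0r sub0r mulNr; congr (- _).
case: (posnP k) t1 va => [k0|k0] t1 va.
  by move: t1; rewrite /L k0 /= => ->.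
rewrite (_ : theta.[a] = 0) ?gtn_eqF// ?mul0r//.
have L0 : (0 < mult_left k)%N by rewrite /mult_left uphalf_gt0.
by have := pjet_dvdp va L0; rewrite /pjet derivn0.
Qed.

(** Up to normalization this is the weight that the rule gives to the
    derivative of order k./2 at b.  Replacing one factor N of N * N by its value
    at b costs a multiple of X - b, which completes the other factors to the
    nodal polynomial and integrates to zero; so this integral times N(b) is the
    integral of a function of one sign. *)
Lemma last_weight_neq0 :
  pint a b (('X - a%:P) ^+ L * ('X - b%:P) ^+ k./2 * Nd) != 0.
Proof.
set w := _ ^+ L * _; apply/eqP => I0.
have /dvdpP[e eE] : 'X - b%:P %| Nd - Nd.[b]%:P.
  by rewrite dvdp_XsubCl rootE !hornerE subrr.
have w0 : w != 0.
  by rewrite mulf_neq0// expf_neq0// polyXsubC_eq0.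
have N0 := interior_poly_neq0 ab.
have pos : 0 < pint a b ((-1) ^+ k./2 *: (w * Nd * Nd)).
  apply: pint_gt0 => //.
    rewrite scaler_eq0 negb_or signr_eq0 /=.
    by apply: (mulf_neq0 _ N0); exact: (mulf_neq0 w0 N0).
  move=> x /andP[ax xb]; rewrite hornerZ !hornerM !horner_exp !hornerXsubC.
  rewrite (_ : _ * _ = (x - a) ^+ L * (b - x) ^+ k./2 * Nd.[x] ^+ 2).
    by rewrite mulr_ge0 ?sqr_ge0// mulr_ge0// exprn_ge0// subr_ge0 ltW.
  by rewrite -[b - x]opprB (exprNn (x - b)); ring.
move: pos; rewrite pintZ//.
have -> : w * Nd * Nd = Nd.[b] *: (w * Nd) + J * e.
  have NE : Nd = Nd.[b]%:P + e * ('X - b%:P) by rewrite -eE subrKC.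
  rewrite [X in w * Nd * X = _]NE -mul_polyC /nodal_poly /w /mult_right exprS.
  by ring.
rewrite pintD// pintZ// I0 nodal_poly_orth ?mulr0 ?addr0 ?mulr0 ?ltxx//.
have [->|e0] := eqVneq e 0; first by rewrite size_poly0.
have : (size (Nd - Nd.[b]%:P)%R <= (r - k).+1)%N.
  rewrite (leq_trans (size_polyD _ _))// size_polyN size_interior_poly//.
  by rewrite geq_max leqnn (leq_trans (size_polyC_leq1 _)).
by rewrite eE size_Mmonic ?monicXsubC// size_XsubC addn2.
Qed.

(** The products of f and g with the interior polynomial have the same Hermite
    data, except perhaps for the derivative of order k./2 at b.  Equal values
    under the rule force this one to agree as well, because its weight is not
    zero. *)
Lemma Qrk_last_condition f (g : {poly R}) s : (size g <= r.+1)%N ->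
  jet a^'+ L f (pjet g a) -> jet b^'- Rr f s ->
  (forall i, (i < k./2)%N -> s i = pjet g b i) ->
  Qrk t th n (fun x => f x * Nd.[x]) = pint a b (g * Nd) ->
  s k./2 = pjet g b k./2.
Proof.
move=> sg ja jb sE QE.
have [S hS] := ex_taylor b s Rr.
have J0 := nodal_poly_neq0 ab.
have /dvdpP[h hE] : ('X - b%:P) ^+ k./2 %| S - g.
  by apply/dvdpB_pjet => i ik; rewrite hS ?sE// /Rr /mult_right ltnW.
set w := ('X - a%:P) ^+ L * ('X - b%:P) ^+ k./2.
(* c makes p2 agree with f * Nd in the derivative of order k./2 at b; the added
   term does not change the other Hermite data. *)
pose c := h.[b] / (b - a) ^+ L.
pose p1 := (g * Nd) %% J.
pose p2 := p1 + c *: (w * Nd).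
have p1E : g * Nd = (g * Nd) %/ J * J + p1 by exact: divp_eq.
have pintp1 : pint a b (g * Nd) = pint a b p1.
  rewrite p1E pintD// mulrC nodal_poly_orth ?add0r//.
  rewrite size_divp// size_nodal_poly//= leq_subLR.
  rewrite (leq_trans (size_polyMleq _ _))// size_interior_poly//; lia.
have ba0 : b - a != 0 by rewrite subr_eq0 gt_eqF.
have sp2 : (size p2 <= r.+1)%N.
  rewrite (leq_trans (size_polyD _ _))// geq_max; apply/andP; split.
    by have := ltn_modp (g * Nd) J; rewrite J0 size_nodal_poly.
  rewrite (leq_trans (size_scale_leq _ _))// /w.
  have X0 (e : R) m : ('X - e%:P) ^+ m != 0 by rewrite expf_neq0 ?polyXsubC_eq0.
  rewrite !size_mul ?mulf_neq0 ?interior_poly_neq0//.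
  rewrite !size_exp_XsubC size_interior_poly//.
  have := mult_leftD_right k; rewrite -/L /mult_right; lia.
have : Qrk t th n (fun x => f x * Nd.[x]) = pint a b p2.
  apply: Qrk_jet => //.
  - apply: (jet_ext (one_sided_right a)) (jetM (one_sided_right a) ja
      (jet_horner (one_sided_right a) _ Nd)) => //.
      by near=> x.
    apply/dvdpB_pjet.
    rewrite p1E /p2 opprD addrA addrK; apply: dvdp_sub.
      by rewrite dvdp_mull// /nodal_poly -mulrA dvdp_mulr.
    by rewrite -mul_polyC dvdp_mull// /w -mulrA dvdp_mulr.
  - have jb' : jet b^'- Rr f (pjet S b).
      by apply: (jet_ext (one_sided_left b)) jb => [|i iR];
        [near=> x|rewrite hS].
    apply: (jet_ext (one_sided_left b)) (jetM (one_sided_left b) jb'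
      (jet_horner (one_sided_left b) _ Nd)) => //.
      by near=> x.
    apply/dvdpB_pjet.
    have -> : S * Nd - p2 = (g * Nd) %/ J * J + ('X - b%:P) ^+ k./2 *
      (h - c *: ('X - a%:P) ^+ L) * Nd.
      have -> : S = g + h * ('X - b%:P) ^+ k./2 by rewrite -hE subrKC.
      move: p1E; set q1 := _ %/ J => p1E.
      by rewrite mulrDl p1E /p2 /w -!mul_polyC; ring.
    apply: dvdp_add.
      by rewrite dvdp_mull// /nodal_poly mulrAC dvdp_mull.
    rewrite dvdp_mulr// /mult_right exprSr dvdp_mul// dvdp_XsubCl rootE.
    by rewrite hornerD hornerN hornerZ horner_exp hornerXsubC divfK ?subrr
      ?expf_neq0.
  - move=> i; rewrite /p2 hornerD hornerZ hornerM root_interior_poly// !mulr0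
    addr0.
    have : (g * Nd).[from_ref a b (th i)] = p1.[from_ref a b (th i)].
      rewrite {1}p1E hornerD hornerM /nodal_poly hornerM root_interior_poly//.
      by rewrite !mulr0 add0r.
    by move=> <-; rewrite hornerM root_interior_poly// !mulr0.
rewrite QE pintp1 pintD// pintZ// => /eqP.
rewrite -[X in X == _]addr0 (inj_eq (addrI _)) eq_sym mulf_eq0.
rewrite (negPf last_weight_neq0) orbF mulf_eq0 invr_eq0 expf_eq0 (negPf ba0)
  andbF orbF.
move=> /eqP hb0.
have /dvdpB_pjet Sg : ('X - b%:P) ^+ Rr %| S - g.
  by rewrite hE /Rr /mult_right exprS dvdp_mul// dvdp_XsubCl rootE hb0.
by rewrite -hS// Sg.
Unshelve. all: by end_near. Qed.

End Rule.
End Quadrature.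

(** * Functions that are polynomial on an interval *)

Section Piece.
Context {R : realType} (d : nat) (F : R * 'cV[R]_d -> 'cV[R]_d) (A B : R).
Context (K : nat -> R -> (nat -> 'cV[R]_d) -> 'cV[R]_d) (m : nat).
Context (Kjet : forall (c : R) (Gf : set_system R) p, one_sided c Gf ->
  A <= c <= B -> (\forall x \near Gf, A < x < B) ->
  vjet Gf m (fun x => F (x, vpoly p x)) (fun n => K n c (vpjet p c))).
Context (a b : R) (ab : a < b) (Aa : A <= a) (bB : b <= B).
Context (V : R -> 'cV[R]_d) (v : 'cV[{poly R}]_d).
Context (hV : forall x, a < x <= b -> V x = vpoly v x).

Let hV' x : a < x < b -> vpoly v x = V x.
Proof. by move=> /andP[ax xb]; rewrite hV// ax ltW. Qed.

Lemma vjet_piece_right n : vjet a^'+ n V (vpjet v a).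
Proof.
apply: (vjet_ext (one_sided_right a)) (vjet_vpoly (one_sided_right a) n v)
  => //.
by apply: filterS (near_right_oo ab) => x /hV'.
Qed.

Lemma vjet_piece_left n : vjet b^'- n V (vpjet v b).
Proof.
apply: (vjet_ext (one_sided_left b)) (vjet_vpoly (one_sided_left b) n v) => //.
by apply: filterS (near_left_oo ab) => x /hV'.
Qed.

Lemma right_lim_piece i : right_lim (derive1n i V) a = vpjet v a i.
Proof.
exact: vjet_lim_eq (one_sided_right a) _ _ _ _ (vjet_piece_right i.+1)
  (leqnn _).
Qed.

Lemma left_lim_piece i : left_lim (derive1n i V) b = vpjet v b i.
Proof.
exact: vjet_lim_eq (one_sided_left b) _ _ _ _ (vjet_piece_left i.+1) (leqnn _).
Qed.

Lemma F_vjet_right :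
  vjet a^'+ m (fun x => F (x, V x)) (fun n => K n a (vpjet v a)).
Proof.
have aAB : A <= a <= B by rewrite Aa (le_trans (ltW ab)).
have nAB : \forall x \near a^'+, A < x < B.
  apply: filterS (near_right_oo ab) => x /andP[ax xb].
  by rewrite (le_lt_trans Aa)//= (lt_le_trans xb).
apply: (vjet_ext (one_sided_right a)) (Kjet v (one_sided_right a) aAB nAB)
  => //.
by apply: filterS (near_right_oo ab) => x /hV' ->.
Qed.

Lemma F_vjet_left :
  vjet b^'- m (fun x => F (x, V x)) (fun n => K n b (vpjet v b)).
Proof.
have bAB : A <= b <= B by rewrite bB (le_trans Aa (ltW ab)).
have nAB : \forall x \near b^'-, A < x < B.
  apply: filterS (near_left_oo ab) => x /andP[ax xb].
  by rewrite (le_lt_trans Aa)//= (lt_le_trans xb).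
apply: (vjet_ext (one_sided_left b)) (Kjet v (one_sided_left b) bAB nAB) => //.
by apply: filterS (near_left_oo ab) => x /hV' ->.
Qed.

Lemma right_lim_F i : (i < m)%N ->
  right_lim (derive1n i (fun x => F (x, V x))) a = K i a (vpjet v a).
Proof. exact: vjet_lim_eq (one_sided_right a) _ _ _ _ F_vjet_right. Qed.

Lemma left_lim_F i : (i < m)%N ->
  left_lim (derive1n i (fun x => F (x, V x))) b = K i b (vpjet v b).
Proof. exact: vjet_lim_eq (one_sided_left b) _ _ _ _ F_vjet_left. Qed.

Lemma derive1_piece x : a < x < b -> derive1 V x = vpoly (map_mx deriv v) x.
Proof.
move=> /andP[ax xb]; rewrite -derive1_vpoly !derive1E; apply: near_eq_derive.
near=> y; apply/esym/hV'; apply/andP; split; near: y.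
  exact: lt_nbhsr.
exact: lt_nbhsl.
Unshelve. all: by end_near. Qed.

End Piece.

Lemma size_pdot (R : realType) d (p q : 'cV[{poly R}]_d) m n :
  vdeg_lt m p -> vdeg_lt n q -> (size (pdot p q) <= (m + n).-1)%N.
Proof.
move=> hp hq; rewrite (leq_trans (size_sum _ _ _))//.
apply/bigmax_leqP => l _; rewrite (leq_trans (size_polyMleq _ _))//.
by have := hp l; have := hq l; lia.
Qed.

Lemma vdeg_lt_mulmx (R : realType) d (M : 'M[R]_d) (p : 'cV[{poly R}]_d) m :
  vdeg_lt m p -> vdeg_lt m (map_mx polyC M *m p).
Proof.
move=> hp l; rewrite mxE (leq_trans (size_sum _ _ _))//.
apply/bigmax_leqP => i _; rewrite mxE mul_polyC.
exact: leq_trans (size_scale_leq _ _) (hp i).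
Qed.

Lemma vdeg_lt_deriv (R : realType) d (p : 'cV[{poly R}]_d) m :
  vdeg_lt m.+1 p -> vdeg_lt m (map_mx deriv p).
Proof.
move=> hp l; rewrite mxE; have [->|p0] := eqVneq (p l ord0) 0.
  by rewrite deriv0 size_poly0.
by rewrite -ltnS (leq_trans (lt_size_deriv p0)).
Qed.

(** This polynomial stands for the exact solution in the recursion that defines
    its derivatives at t0. *)
Lemma vpjet_taylor (R : realType) d (ud : nat -> 'cV[R]_d) (c : R) j :
  exists2 p, (forall x, vpoly p x
      = \sum_(i < j.+1) ((x - c) ^+ i / (i`!)%:R) *: ud i) &
    forall m, (m <= j)%N -> vpjet p c m = ud m.
Proof.
exists (\col_l \sum_(i < j.+1) (ud i l ord0 / (i`!)%:R)%:P * ('X - c%:P) ^+ i).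
  move=> x; apply/colP => l; rewrite !mxE horner_sum summxE.
  apply: eq_bigr => i _; rewrite hornerM hornerC horner_exp hornerXsubC mxE.
  by rewrite mulrAC [RHS]mulrAC [ud _ _ _ * _]mulrC.
move=> m mj; apply/colP => l; rewrite !mxE.
rewrite (big_morph (fun u : {poly R} => pjet u c m) (id1 := 0) (op1 := +%R)).
- rewrite (bigD1 (inord m)) //= inordK// pjet_top hornerC -mulr_natr divfK.
    rewrite big1 ?addr0// => i im.
    have {im} : (i : nat) != m.
      by apply: contra im => /eqP im; apply/eqP/val_inj; rewrite /= inordK// im.
    rewrite neq_ltn => /orP[im|mi]; last by rewrite (@pjet_dvdp _ _ _ i)//
      dvdp_mull.
    rewrite /pjet derivn_poly0 ?horner0// mul_polyC.
    by rewrite (leq_trans (size_scale_leq _ _))// size_exp_XsubC.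
  by rewrite pnatr_eq0 -lt0n fact_gt0.
- by move=> p1 p2; exact: pjetD.
- by rewrite -(scale0r 0) pjetZ mul0r.
Qed.

(** * The correction on one mesh interval *)

Section Step.
Context {R : realType} (d : nat) (F : R * 'cV[R]_d -> 'cV[R]_d) (A B : R).
Context (M : 'M[R]_d).
(* K n c y is the n-th total derivative of F at c along a curve whose
   derivatives at c are y 0, y 1, and so on. *)
Context (K : nat -> R -> (nat -> 'cV[R]_d) -> 'cV[R]_d).
Context (r k : nat) (th : 'I_(r - k) -> R) (hkr : (k <= r)%N).
Context (hth : jacobi_nodes th).
Context (Kdep : forall n x y y', (forall m, (m <= n)%N -> y m = y' m) ->
  K n x y = K n x y').
Context (Kjet : forall (c : R) (Gf : set_system R) p, one_sided c Gf ->
  A <= c <= B -> (\forall x \near Gf, A < x < B) ->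
  vjet Gf (mult_right k) (fun x => F (x, vpoly p x))
    (fun n => K n c (vpjet p c))).
Context (t : nat -> R) (n : nat).
Let a := t n.-1.
Let b := t n.
Context (ab : a < b) (Aa : A <= a) (bB : b <= B).
Context (theta : {poly R}) (stheta : (size theta <= r.+2)%N).
Context (vtheta : vanishes_at_nodes th a b theta).
Context (theta1 : (derivn (mult_left k) theta).[a] = 1).
Context (U Ut : R -> 'cV[R]_d) (p q : 'cV[{poly R}]_d) (av : 'cV[R]_d).
Context (hU : forall x, a < x <= b -> U x = vpoly p x).
Context (hUt : forall x, a < x <= b -> Ut x = vpoly q x).
Context (hp : vdeg_lt r.+1 p).
Context (qE : forall l, q l ord0 = p l ord0 - av l ord0 *: theta).

Lemma vdeg_corrected : vdeg_lt r.+2 q.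
Proof.
move=> l; rewrite qE (leq_trans (size_polyD _ _))// geq_max size_polyN.
by rewrite (leq_trans (hp l))//= (leq_trans (size_scale_leq _ _)).
Qed.

Lemma vpjet_corrected_right i : (i < mult_right k)%N ->
  vpjet q b i = vpjet p b i.
Proof.
move=> iR; apply/colP => l; rewrite !mxE qE pjetB pjetZ.
by have [_ vb _] := vtheta; rewrite (pjet_dvdp vb iR) mulr0 subr0.
Qed.

Lemma vpjet_corrected_left i : (i < mult_left k)%N -> vpjet q a i = vpjet p a i.
Proof.
move=> iL; apply/colP => l; rewrite !mxE qE pjetB pjetZ.
by have [va _ _] := vtheta; rewrite (pjet_dvdp va iL) mulr0 subr0.
Qed.

Lemma vpjet_corrected_top :
  vpjet q a (mult_left k) = vpjet p a (mult_left k) - av.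
Proof.
by apply/colP => l; rewrite !mxE qE pjetB pjetZ {2}/pjet theta1 mulr1.
Qed.

Lemma corrected_node i :
  Ut (from_ref a b (th i)) = U (from_ref a b (th i)).
Proof.
have [P hP [th_inj hroot]] := hth.
have /andP[ax xb] := node_in hroot ab i.
rewrite hU ?hUt ?ax ?ltW//; apply/colP => l; rewrite !mxE qE.
have [_ _ /(_ i) /eqP h] := vtheta.
by rewrite hornerD hornerN hornerZ h mulr0 subr0.
Qed.

(** The derivatives of F(., U) and F(., Ut) at the end points that enter the
    rule depend on derivatives of p and q that agree there. *)
Lemma Qrk_F_corrected phi :
  Qrk t th n (fun x => dot (F (x, Ut x)) (vpoly phi x))
  = Qrk t th n (fun x => dot (F (x, U x)) (vpoly phi x)).
Proof.
have [P hP [th_inj hroot]] := hth.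
have [Sa hSa] := ex_vtaylor a (fun i => K i a (vpjet p a)) (mult_left k).
have [Sb hSb] := ex_vtaylor b (fun i => K i b (vpjet p b)) (mult_right k).
have L := mult_left_le_right k.
apply: (@Qrk_ext _ _ _ _ _ _ ab _ _ (pdot Sa phi) (pdot Sb phi)).
- apply: (jet_dot _ (one_sided_right a)).
  apply: (vjet_ext (one_sided_right a))
    (vjet_mono L (F_vjet_right Kjet ab Aa bB hUt)).
    by near=> x.
  move=> i iL; rewrite hSa//; apply: Kdep => m mi.
  by rewrite vpjet_corrected_left// (leq_ltn_trans mi).
- apply: (jet_dot _ (one_sided_left b)).
  apply: (vjet_ext (one_sided_left b)) (F_vjet_left Kjet ab Aa bB hUt).
    by near=> x.
  move=> i iR; rewrite hSb//; apply: Kdep => m mi.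
  by rewrite vpjet_corrected_right// (leq_ltn_trans mi).
- apply: (jet_dot _ (one_sided_right a)).
  apply: (vjet_ext (one_sided_right a))
    (vjet_mono L (F_vjet_right Kjet ab Aa bB hU)).
    by near=> x.
  by move=> i iL; rewrite hSa.
- apply: (jet_dot _ (one_sided_left b)).
  apply: (vjet_ext (one_sided_left b)) (F_vjet_left Kjet ab Aa bB hU).
    by near=> x.
  by move=> i iR; rewrite hSb.
- by move=> i; rewrite corrected_node.
Unshelve. all: by end_near. Qed.

Lemma Qrk_derivative V v phi : (forall x, a < x <= b -> V x = vpoly v x) ->
  vdeg_lt r.+2 v -> vdeg_lt (r - k).+1 phi ->
  Qrk t th n (fun x => dot (M *m derive1 V x) (vpoly phi x))
  = pint a b (pdot (map_mx polyC M *m map_mx deriv v) phi).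
Proof.
move=> hV hv hphi; have [P hP [th_inj hroot]] := hth.
apply: (Qrk_exact hkr hP th_inj hroot ab).
  rewrite (leq_trans (size_pdot (vdeg_lt_mulmx M (vdeg_lt_deriv hv)) hphi))//.
  by rewrite addSn addnS.
move=> x xab; rewrite (derive1_piece hV)//.
by rewrite horner_pdot vpoly_mulmx.
Qed.

(** The boundary term of the correction equals the jump term of the
    discontinuous method when av is the jump. *)
Lemma pint_corrected phi : vdeg_lt (r - k).+1 phi ->
  pint a b (pdot (map_mx polyC M *m map_mx deriv q) phi)
  = pint a b (pdot (map_mx polyC M *m map_mx deriv p) phi)
    + (k == 0%N)%:R * dot (M *m av) (vpoly phi a).
Proof.
move=> hphi; have [P hP [th_inj hroot]] := hth.
pose psi := pdot (map_mx polyC (M *m av)) phi.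
have spsi : (size psi <= (r - k).+1)%N.
  have h1 : vdeg_lt 1 (map_mx polyC (M *m av)).
    by move=> l; rewrite mxE size_polyC_leq1.
  exact: leq_trans (size_pdot h1 hphi) _.
have -> : pdot (map_mx polyC M *m map_mx deriv q) phi
    = pdot (map_mx polyC M *m map_mx deriv p) phi - theta^`() * psi.
  rewrite /psi /pdot mulr_sumr -sumrB; apply: eq_bigr => l _.
  rewrite mulrA -mulrBl; congr (_ * _); rewrite map_mxM !mxE mulr_sumr -sumrB.
  apply: eq_bigr => i _; rewrite !mxE qE derivB derivZ -mul_polyC; ring.
rewrite pintB// (pint_bubble hkr hP th_inj hroot ab)// mulNr opprK.
congr (_ + _ * _); rewrite /psi horner_pdot; congr dot.
by apply/colP => l; rewrite !mxE hornerC.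
Qed.

(* Delta is the jump of U at a. *)
Context (Delta : 'cV[R]_d) (avE : k = 0%N -> av = Delta).
Context (hQ : forall phi : 'cV[{poly R}]_d, vdeg_lt (r.+1 - k) phi ->
  Qrk t th n (fun x => dot (M *m derive1 U x) (vpoly phi x))
  + (k == 0%N)%:R * dot (M *m Delta) (vpoly phi a)
  = Qrk t th n (fun x => dot (F (x, U x)) (vpoly phi x))).

Lemma Qrk_corrected phi : vdeg_lt (r - k).+1 phi ->
  pint a b (pdot (map_mx polyC M *m map_mx deriv q) phi)
  = Qrk t th n (fun x => dot (F (x, Ut x)) (vpoly phi x)).
Proof.
move=> hphi; rewrite Qrk_F_corrected -hQ ?subSn// pint_corrected//.
rewrite (Qrk_derivative hU)//; last by move=> l; exact: leqW (hp l).
by case: eqP => [/avE ->|_]; rewrite ?mul0r.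
Qed.

(** The test function is the interior polynomial in component l, so that the
    equation isolates component l of the residual. *)
Lemma collocation_right :
  (forall i, (i < mult_left k)%N -> M *m vpjet q a i.+1 = K i a (vpjet q a)) ->
  (forall i, (i < k./2)%N -> M *m vpjet q b i.+1 = K i b (vpjet q b)) ->
  M *m vpjet q b (k./2).+1 = K k./2 b (vpjet q b).
Proof.
move=> ca cb; have [P hP [th_inj hroot]] := hth.
pose g := map_mx polyC M *m map_mx deriv q.
have gE c i : vpjet g c i = M *m vpjet q c i.+1.
  by rewrite /g vpjet_mulmx vpjetS.
have hg : vdeg_lt r.+1 g.
  by apply: vdeg_lt_mulmx; exact: vdeg_lt_deriv vdeg_corrected.
rewrite -gE; apply/colP => l.
pose N := interior_poly P a b.
pose phi : 'cV[{poly R}]_d := \col_i (if i == l then N else 0).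
have hphi : vdeg_lt (r - k).+1 phi.
  move=> i; rewrite mxE; case: ifP => _; last by rewrite size_poly0.
  by rewrite (size_interior_poly hP ab).
have dotE (y : 'cV[R]_d) x : dot y (vpoly phi x) = y l ord0 * N.[x].
  rewrite /dot (bigD1 l)//= !mxE eqxx big1 ?addr0// => i il.
  by rewrite !mxE (negPf il) horner0 mulr0.
have pdotE : pdot g phi = g l ord0 * N.
  rewrite /pdot (bigD1 l)//= [phi l _]mxE eqxx big1 ?addr0// => i il.
  by rewrite [phi i _]mxE (negPf il) mulr0.
have := Qrk_corrected hphi; rewrite -/g pdotE.
under [X in _ = Qrk _ _ _ X -> _]eq_fun do rewrite dotE.
move=> /esym QE; rewrite [LHS]mxE; apply/esym.
apply: (Qrk_last_condition hkr hP th_inj hroot ab (hg l) _ _ _ QE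
  (s := fun i => K i b (vpjet q b) l ord0)).
- have := vjet_mono (mult_left_le_right k) (F_vjet_right Kjet ab Aa bB hUt).
  move=> /(_ l); apply: (jet_ext (one_sided_right a)) => [|i iL].
    by near=> x.
  by rewrite -ca// -gE mxE.
- exact: (F_vjet_left Kjet ab Aa bB hUt).
- by move=> i ik; rewrite -cb// -gE mxE.
Unshelve. all: by end_near. Qed.

End Step.

(** * Induction over the mesh *)

Lemma mesh_le (R : realType) (t0 T : R) N t i j : mesh t0 T N t ->
  (i <= j <= N)%N -> t i <= t j.
Proof.
move=> [_ _ tS]; elim: j => [|j IH]; first by rewrite leqn0 => /andP[/eqP ->].
rewrite leq_eqVlt => /andP[/predU1P[->//|ij] jN].
by rewrite (le_trans (IH _)) ?(ltW (tS _ jN))// -ltnS ij ltnW.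
Qed.

Theorem corollary3p3 (R : realType) (d : nat)
    (M : 'M[R]_d) (F : R * 'cV[R]_d -> 'cV[R]_d) (t0 T : R) (u0 : 'cV[R]_d)
    (ud : nat -> 'cV[R]_d) (N : nat) (t : nat -> R)
    (r k : nat) (th : 'I_(r - k) -> R)
    (U : R -> 'cV[R]_d) (U0 : 'cV[R]_d)
    (Ut : R -> 'cV[R]_d) (Ut0 : 'cV[R]_d)
    (a : nat -> 'cV[R]_d) (theta : nat -> {poly R})
    (hM : M \in unitmx) (hT : 0 < T)
    (hF : Cj_strip t0 (t0 + T) k./2 F)
    (hL : exists L : R, forall x, t0 <= x <= t0 + T ->
            L.-lipschitz (fun y : 'cV[R]_d => F (x, y)))
    (hud : initial_derivatives F M t0 u0 ud)
    (ht : mesh t0 T N t)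
    (hkr : (k <= r)%N)
    (hth : jacobi_nodes th)
    (hU : VTD F M u0 N t (Qrk t th) r k U U0)
    (htheta : forall n, (0 < n <= N)%N ->
       [/\ (size (theta n) <= r.+2)%N,
           vanishes_at_nodes th (t n.-1) (t n) (theta n) &
           (derivn (mult_left k) (theta n)).[t n.-1] = 1])
    (hUt : forall n, (0 < n <= N)%N -> forall x, t n.-1 < x <= t n ->
       Ut x = U x - (theta n).[x] *: a n)
    (ha1 : a 1%N = right_lim (derive1n (mult_left k) U) t0 - ud (mult_left k))
    (ha : forall n, (1 < n <= N)%N ->
       a n = right_lim (derive1n (mult_left k) U) (t n.-1)
             - left_lim (derive1n (mult_left k) Ut) (t n.-1))
    (hUt0 : Ut0 = U0) :
  VTD F M u0 N t (Qrk t th) r.+1 k.+2 Ut Ut0.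
Proof.
have [hY U0E hUn] := hU; have [ud0 udS] := hud; have [tt0 ttN tS] := ht.
have LR := mult_left_le_right k.
have [K Kdep Kjet] := total_derivatives hF.
have {}Kjet : forall (c : R) (Gf : set_system R) p, one_sided c Gf ->
    t0 <= c <= t0 + T -> (\forall x \near Gf, t0 < x < t0 + T) ->
    vjet Gf (mult_right k) (fun x => F (x, vpoly p x))
      (fun n => K n c (vpjet p c)).
  exact: Kjet.
have /choice[p hp] : forall n, exists p, (0 < n <= N)%N ->
    vdeg_lt r.+1 p /\ forall x, t n.-1 < x <= t n -> U x = vpoly p x.
  move=> n; case: (boolP (0 < n <= N)%N) => [/hY[p sp pE]|_]; last by exists 0.
  by exists p.
pose q n : 'cV[{poly R}]_d := \col_l (p n l ord0 - a n l ord0 *: theta n).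
have qE n l : q n l ord0 = p n l ord0 - a n l ord0 *: theta n by rewrite mxE.
have hq n : (0 < n <= N)%N -> forall x, t n.-1 < x <= t n ->
    Ut x = vpoly (q n) x.
  move=> nN x xab; rewrite (hUt _ nN)// (hp n nN).2//; apply/colP => l.
  by rewrite !mxE hornerD hornerN hornerZ mulrC.
have tlt n : (0 < n <= N)%N -> t n.-1 < t n.
  by case: n => [//|n] /= nN; exact: tS.
have tA n : (0 < n <= N)%N -> t0 <= t n.-1.
  by move=> nN; rewrite -tt0 (mesh_le ht)//; case/andP: nN; lia.
have tB n : (0 < n <= N)%N -> t n <= t0 + T.
  by move=> nN; rewrite -ttN (mesh_le ht)//; case/andP: nN; lia.
have pjb n (nN : (0 < n <= N)%N) i : (i < mult_right k)%N ->
    vpjet (q n) (t n) i = vpjet (p n) (t n) i.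
  have [_ vt _] := htheta n nN.
  exact: (vpjet_corrected_right (t := t) (n := n) vt (qE n)).
have pja n (nN : (0 < n <= N)%N) i : (i < mult_left k)%N ->
    vpjet (q n) (t n.-1) i = vpjet (p n) (t n.-1) i.
  have [_ vt _] := htheta n nN.
  exact: (vpjet_corrected_left (t := t) (n := n) vt (qE n)).
have Uright n (nN : (0 < n <= N)%N) := right_lim_piece (tlt n nN) (hp n nN).2.
have Uleft n (nN : (0 < n <= N)%N) := left_lim_piece (tlt n nN) (hp n nN).2.
have Utright n (nN : (0 < n <= N)%N) := right_lim_piece (tlt n nN) (hq n nN).
have Utleft n (nN : (0 < n <= N)%N) := left_lim_piece (tlt n nN) (hq n nN).
(* The data with which interval n + 1 starts: w n i stands for the derivative of
   order i of the corrected solution at t n from the left, and for n = 0 of the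
   exact solution. *)
pose w n : nat -> 'cV[R]_d := if n is 0%N then ud else vpjet (q n) (t n).
have w0 n : (n <= N)%N -> left_value t U U0 n = w n 0%N.
  case: n => [|n] nN /=; first by rewrite U0E ud0.
  by rewrite (Uleft n.+1 nN 0) pjb.
have w0t n : (n <= N)%N -> left_value t Ut Ut0 n = w n 0%N.
  case: n => [|n] nN /=; first by rewrite hUt0 U0E ud0.
  exact: (Utleft n.+1 nN 0).
have aE n : (0 < n <= N)%N ->
    a n = vpjet (p n) (t n.-1) (mult_left k) - w n.-1 (mult_left k).
  case: n => [//|[|n]] nN; first by rewrite ha1 -tt0 (Uright 1%N nN).
  by rewrite ha// (Uright n.+2 nN) (Utleft n.+1)//= ltnW.
pose collocated n := forall i, (i < mult_right k)%N ->
  M *m w n i.+1 = K i (t n) (w n).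
(* Matching of the derivatives at the left end.  Below order L, the collocation
   conditions of U and those of w determine them by the same recursion, as M is
   invertible; the choice of a n takes care of order L. *)
have cont n : (0 < n <= N)%N -> collocated n.-1 -> forall j,
    (j <= mult_left k)%N -> vpjet (q n) (t n.-1) j = w n.-1 j.
  move=> nN cn.
  have low j : (j < mult_left k)%N -> vpjet (q n) (t n.-1) j = w n.-1 j.
    elim/ltn_ind: j => -[|j] IH jL; rewrite pja//.
      have [h1 _ _ _] := hUn n nN; rewrite -w0; last by lia.
      rewrite -h1; first by rewrite -(Uright n nN 0).
      by move: jL; rewrite /mult_left uphalf_gt0.
    have jk : (j < k.-1./2)%N by move: jL; rewrite /mult_left; lia.
    have k3 : (2 < k)%N by lia.
    have jR : (j < mult_right k)%N by rewrite (leq_trans _ LR)// ltnW.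
    have [_ _ /(_ k3 j jk) h3 _] := hUn n nN.
    apply: (can_inj (mulKmx hM)); rewrite cn// -(Uright n nN) h3.
    rewrite (right_lim_F Kjet (tlt n nN) (tA n nN) (tB n nN) (hp n nN).2)//.
    apply: Kdep => m mj; have mL : (m < mult_left k)%N.
      by rewrite (leq_ltn_trans mj)// ltnW.
    by rewrite -pja// IH.
  move=> j; rewrite leq_eqVlt => /predU1P[->|]; last exact: low.
  have [_ _ th1] := htheta n nN.
  by rewrite (vpjet_corrected_top (t := t) (n := n) th1 (qE n)) aE// subKr.
(* The collocation conditions travel through t n.-1, since L <= l and the
   derivatives involved are continuous. *)
have colR n : (0 < n <= N)%N -> collocated n.-1 -> forall i,
    (i < mult_left k)%N ->
    M *m vpjet (q n) (t n.-1) i.+1 = K i (t n.-1) (vpjet (q n) (t n.-1)).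
  move=> nN cn i iL; rewrite cont// cn ?(leq_trans iL)//.
  by apply: Kdep => m mi; rewrite cont// (leq_trans mi)// ltnW.
have hQ n (nN : (0 < n <= N)%N) := let: And4 _ _ _ h := hUn n nN in h.
have avE n : (0 < n <= N)%N -> k = 0%N ->
    a n = right_lim U (t n.-1) - left_value t U U0 n.-1.
  move=> nN k0; have L0 : mult_left k = 0%N by rewrite k0.
  by rewrite aE// L0 -(Uright n nN) w0//; lia.
have colL n : (0 < n <= N)%N -> collocated n.-1 -> collocated n.
  move=> nN cn; have -> : collocated n = forall i, (i < mult_right k)%N ->
      M *m vpjet (q n) (t n) i.+1 = K i (t n) (vpjet (q n) (t n)).
    by case: (n) nN.
  have low i : (i < k./2)%N ->
      M *m vpjet (q n) (t n) i.+1 = K i (t n) (vpjet (q n) (t n)).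
    move=> ik; have [_ h2 _ _] := hUn n nN.
    rewrite pjb// -(Uleft n nN) h2//; last by lia.
    rewrite (left_lim_F Kjet (tlt n nN) (tA n nN) (tB n nN) (hp n nN).2)//; last
      first.
      by rewrite ltnW.
    apply: Kdep => m mi; rewrite pjb//.
    by rewrite /mult_right ltnS (leq_trans mi)// ltnW.
  move=> i; rewrite /mult_right ltnS leq_eqVlt => /predU1P[->|]; last exact:
    low.
  have [st vt t1] := htheta n nN.
  apply: (collocation_right hkr hth Kdep Kjet (t := t) (n := n)
    (tlt n nN) (tA n nN) (tB n nN) st vt t1 (hp n nN).2 (hq n nN) (hp n nN).1
      (qE n) _ (hQ n nN)) => //.
    exact: avE.
  exact: colR.
have col n : (n <= N)%N -> collocated n.
  elim: n => [_|n IH nN]; last by apply: (colL n.+1) => //; exact/IH/ltnW.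
  move=> i iR; rewrite /= udS tt0.
  have [tp tpE tpj] := vpjet_taylor ud t0 i.
  have -> : (fun x => F (x, \sum_(j < i.+1) ((x - t0) ^+ j / j`!%:R) *: ud j))
      = fun x => F (x, vpoly tp x).
    by apply/funext => x; rewrite tpE.
  have cAB : t0 <= t0 <= t0 + T by rewrite lexx lerDl ltW.
  have tT : t0 < t0 + T by rewrite ltrDl.
  have nAB := near_right_oo tT.
  rewrite /right_lim.
  rewrite (vjet_lim_eq (one_sided_right t0)
    (Kjet _ _ tp (one_sided_right t0) cAB nAB) iR).
  by apply: Kdep => m mi; rewrite tpj.
split.
- move=> n nN; exists (q n); last exact: hq.
  have [st _ _] := htheta n nN.
  refine (vdeg_corrected st (hp n nN).1 (qE n)).
- by rewrite hUt0.
move=> n nN; have nN1 : (n.-1 <= N)%N by lia.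
have cn1 := col _ nN1; have cn : collocated n by apply: col; case/andP: nN.
split.
- move=> _; rewrite w0t//.
  by rewrite (right_lim_piece (tlt n nN) (hq n nN) 0) cont.
- move=> _ i ik.
  rewrite (left_lim_piece (tlt n nN) (hq n nN)).
  rewrite (left_lim_F Kjet (tlt n nN) (tA n nN) (tB n nN) (hq n nN))//.
  by case: (n) nN cn => [//|n'] nN cn; exact: cn.
- move=> _ i ik.
  rewrite (right_lim_piece (tlt n nN) (hq n nN)).
  have iL : (i < mult_left k)%N by [].
  rewrite (right_lim_F Kjet (tlt n nN) (tA n nN) (tB n nN) (hq n nN))
    ?(leq_trans iL)//.
  exact: colR.
- move=> phi; rewrite !subSS => hphi; rewrite mul0r addr0.
  have [st vt t1] := htheta n nN.
  have hphi' : vdeg_lt (r - k).+1 phi by move=> l; exact: leqW (hphi l).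
  rewrite -(Qrk_corrected hkr hth Kdep Kjet (t := t) (n := n)
    (tlt n nN) (tA n nN) (tB n nN) st vt t1 (hp n nN).2 (hq n nN) (hp n nN).1
      (qE n) (avE n nN) (hQ n nN))//.
  apply: (Qrk_derivative M hkr hth (t := t) (n := n) (tlt n nN) (hq n nN)) =>
    //.
  refine (vdeg_corrected st (hp n nN).1 (qE n)).
Qed.
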